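(* Let $(\mathcal{V},\rho_1)$ and $(\mathcal{W},\theta_1)$ be chain complexes of $\mathbb{C}[\partial]$-modules together with contraction data $(p,i,h)$ from $(\mathcal{V},\rho_1)$ to $(\mathcal{W},\theta_1)$. If $(\mathcal{V},\{\rho_k\}_{k\ge1})$ is an $A_\infty[1]$-conformal algebra, then this structure transfers to an $A_\infty[1]$-conformal algebra structure on $(\mathcal{W},\theta_1)$; namely, the maps $\theta_k:=p\circ r_k\circ i^{\otimes k}$, $k\ge2$, where $r_k=\sum_T\rho_T$ is the sum over all isomorphism classes of planar trees $T$ with $k$ leaves, together with $\theta_1$, make $(\mathcal{W},\{\theta_k\}_{k\ge1})$ into an $A_\infty[1]$-conformal algebra.
   Context: All vector spaces and tensor products are over $\mathbb{C}$. A graded $\mathbb{C}[\partial]$-module is $\mathcal{V}=\oplus_{i\in\mathbb{Z}}\mathcal{V}_i$ with each $\mathcal{V}_i$ a $\mathbb{C}[\partial]$-module; $\mathcal{V}[\lambda_1,\ldots,\lambda_{k-1}]$ is graded by $\mathcal{V}_i[\lambda_1,\ldots,\lambda_{k-1}]$, with $\partial$ acting coefficientwise. A $\mathbb{C}$-linear map $\varphi:\mathcal{V}^{\otimes k}\to\mathcal{V}[\lambda_1,\ldots,\lambda_{k-1}]$ is conformal sesquilinear if $\varphi_{\lambda_1,\ldots,\lambda_{k-1}}(v_1,\ldots,\partial v_j,\ldots,v_k)=-\lambda_j\,\varphi_{\lambda_1,\ldots,\lambda_{k-1}}(v_1,\ldots,v_k)$ for $1\le j\le k-1$, and $\varphi_{\lambda_1,\ldots,\lambda_{k-1}}(v_1,\ldots,v_{k-1},\partial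 v_k)=(\partial+\lambda_1+\cdots+\lambda_{k-1})\varphi_{\lambda_1,\ldots,\lambda_{k-1}}(v_1,\ldots,v_k)$. All maps are extended linearly over polynomials in the $\lambda$'s. An $A_\infty[1]$-conformal algebra is a graded $\mathbb{C}[\partial]$-module $\mathcal{V}$ with degree $-1$ conformal sesquilinear maps $\rho_k:\mathcal{V}^{\otimes k}\to\mathcal{V}[\lambda_1,\ldots,\lambda_{k-1}]$, $k\ge1$, such that for all $n\ge1$ and homogeneous $v_1,\ldots,v_n$, $$\sum_{k+l=n+1}\sum_{j=1}^k(-1)^{|v_1|+\cdots+|v_{j-1}|}(\rho_k)_{\lambda_1,\ldots,\lambda_{j-1},\lambda_j+\cdots+\lambda_{j+l-1},\lambda_{j+l},\ldots,\lambda_{n-1}}\big(v_1,\ldots,v_{j-1},(\rho_l)_{\lambda_j,\ldots,\lambda_{j+l-2}}(v_j,\ldots,v_{j+l-1}),v_{j+l},\ldots,v_n\big)=0,$$ where for $j=k$ the subscripts of $\rho_k$ are just $\lambda_1,\ldots,\lambda_{k-1}$. A chain complex of $\mathbb{C}[\partial]$-modules $(\mathcal{V},\rho_1)$ is a graded $\mathbb{C}[\partial]$-module with a $\mathbb{C}[\partial]$-linear degree $-1$ map $\rho_1$ with $\rho_1^2=0$. Contraction data from $(\mathcal{V},\rho_1)$ to $(\mathcal{W},\theta_1)$ consist of $\mathbb{C}[\partial]$-linear chain maps $p:\mathcal{V}\to\mathcal{W}$, $i:\mathcal{W}\to\mathcal{V}$ (degree $0$) and a $\mathbb{C}[\partial]$-linear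 degree $+1$ map $h:\mathcal{V}\to\mathcal{V}$ with $ip-\mathrm{id}_{\mathcal{V}}=\rho_1h+h\rho_1$ and $pi=\mathrm{id}_{\mathcal{W}}$. Planar trees are rooted planar trees all of whose internal vertices have at least two inputs; the tree $|$ is the unique one with one leaf, and every planar tree $T$ with $k\ge2$ leaves is uniquely a grafting $T=T_1\vee\cdots\vee T_l$ with $l\ge2$. Define $\rho_T=\rho_l\big((h\circ\rho_{T_1})\otimes\cdots\otimes(h\circ\rho_{T_l})\big)$ recursively, with the convention $h\circ\rho_{|}=\mathrm{id}_{\mathcal{V}}$. Here for degree $0$ conformal sesquilinear maps $\varphi_1,\ldots,\varphi_l$ with arities $k_1,\ldots,k_l$, $k=k_1+\cdots+k_l$, the map $\rho_l(\varphi_1\otimes\cdots\otimes\varphi_l)$ is obtained by splitting $(v_1,\ldots,v_k)$ into consecutive blocks of sizes $k_1,\ldots,k_l$, applying $\varphi_j$ to the $j$-th block with subscripts the $\lambda$'s of all but the last index of the block, and then applying $(\rho_l)_{\Lambda_1,\ldots,\Lambda_{l-1}}$, where $\Lambda_j$ is the sum of all $\lambda$'s with index in the $j$-th block. *)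

(* Defs.v *)
From HB Require Import structures.
From mathcomp Require Import all_boot all_order all_algebra finmap.
From mathcomp Require Import reals complex.
From mathcomp Require Import mpoly.
(* The notations of monalg clash with those of mpoly.                         *)
From mathcomp Require monalg.
Import (canonicals) monalg.

Set Implicit Arguments.
Unset Strict Implicit.
Unset Printing Implicit Defensive.

Import GRing.Theory.

Local Open Scope ring_scope.

(* A module over C[∂] is an lmodType over {poly C}, ∂ acting as 'X.  The      *)
(* grading is an internal direct sum: [in_degree i v] means v \in V_i.        *)
Record gradedModType (C : fieldType) := GradedModType {
  gm_sort :> lmodType {poly C};
  in_degree : int -> gm_sort -> Prop;
  in_degree0 : forall i, in_degree i 0;
  in_degreeP : forall i (a : {poly C}) u v,
    in_degree i u -> in_degree i v -> in_degree i (a *: u + v);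
  in_degree_span : forall v, exists (s : seq int) (f : int -> gm_sort),
    (forall i, in_degree i (f i)) /\ v = \sum_(i <- s) f i;
  in_degree_indep : forall (s : seq int) (f : int -> gm_sort), uniq s ->
    (forall i, in_degree i (f i)) -> \sum_(i <- s) f i = 0 ->
    forall i, i \in s -> f i = 0
}.

(* V[λ_1, ..., λ_n] for a module V: finitely supported functions from the     *)
(* monomials in n variables to V.                                             *)
Definition lpoly {C : fieldType} (V : lmodType {poly C}) (n : nat) :=
  @monalg.malg 'X_{1..n} V.

HB.instance Definition _ (C : fieldType) (V : lmodType {poly C}) (n : nat) :=
  GRing.Zmodule.on (lpoly V n).

Notation "V '[λ' n ]" := (lpoly V n)
  (at level 2, n at level 99, left associativity, format "V [λ  n ]") : type_scope.

HB.lock Definition lcoef {C : fieldType} {V : lmodType {poly C}} {n : nat}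
    (m : 'X_{1..n}) (x : V[λ n]) : V := monalg.mcoeff m x.

HB.lock Definition lsupp {C : fieldType} {V : lmodType {poly C}} {n : nat}
    (x : V[λ n]) : {fset 'X_{1..n}} := monalg.msupp x.

HB.lock Definition lmonom {C : fieldType} {V : lmodType {poly C}} {n : nat}
    (m : 'X_{1..n}) (v : V) : V[λ n] := monalg.mkmalgU m v.

(* Indices are shifted by one throughout: λ_{a+1} is [lam n a].               *)
Definition lam {C : fieldType} (n a : nat) : {mpoly C[n]} :=
  if insub a is Some i then 'X_i else 0.

Definition cst {C : fieldType} {V : lmodType {poly C}} (n : nat) (v : V) :
  V[λ n] := lmonom 0%MM v.

Definition coefmap {C : fieldType} {V W : lmodType {poly C}} {n : nat}
    (f : V -> W) (x : V[λ n]) : W[λ n] :=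
  \sum_(m <- lsupp x) lmonom m (f (lcoef m x)).

Definition lscale {C : fieldType} {V : lmodType {poly C}} {n : nat}
    (q : {mpoly C[n]}) (x : V[λ n]) : V[λ n] :=
  \sum_(m <- msupp q) \sum_(m' <- lsupp x)
     lmonom (m + m')%MM ((q@_m)%:P *: lcoef m' x).

Definition lsubst {C : fieldType} {V : lmodType {poly C}} {k n : nat}
    (L : 'I_k -> {mpoly C[n]}) (x : V[λ k]) : V[λ n] :=
  \sum_(m <- lsupp x) lscale (mmap1 L m) (cst n (lcoef m x)).

(* Maps V^k -> V[λ_1, ..., λ_{k-1}]; a linear map on the k-fold tensor power  *)
(* is such a map which is [multilinear].  Only arities k >= 1 are meaningful. *)
Definition cmap {C : fieldType} (V : lmodType {poly C}) (k : nat) : Type :=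
  k.-tuple V -> V[λ k.-1].

Definition upd {T : Type} {k : nat} (v : k.-tuple T) (j : 'I_k) (x : T) :
  k.-tuple T := [tuple if a == j then x else tnth v a | a < k].

Definition multilinear {C : fieldType} {V : lmodType {poly C}} {k : nat}
    (phi : cmap V k) : Prop :=
  forall (v : k.-tuple V) (j : 'I_k) (c : C) (x y : V),
    phi (upd v j (c%:P *: x + y)) =
    coefmap (fun u => c%:P *: u) (phi (upd v j x)) + phi (upd v j y).

Definition conformal_sesquilinear {C : fieldType} {V : lmodType {poly C}}
    {k : nat} (phi : cmap V k) : Prop :=
  [/\ multilinear phi,
      forall (v : k.-tuple V) (j : 'I_k), (j < k.-1)%N ->
        phi (upd v j ('X *: tnth v j)) = - lscale (lam k.-1 j) (phi v)
    & forall (v : k.-tuple V) (j : 'I_k), j = k.-1 :> nat ->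
        phi (upd v j ('X *: tnth v j)) =
        coefmap (fun u => 'X *: u) (phi v)
        + lscale (\sum_(a < k.-1) lam k.-1 a) (phi v)].

Definition has_degree {C : fieldType} {V : gradedModType C} {k : nat}
    (e : int) (phi : cmap V k) : Prop :=
  forall (v : k.-tuple V) (d : 'I_k -> int),
    (forall j, in_degree (d j) (tnth v j)) ->
    forall m, in_degree (\sum_(j < k) d j + e) (lcoef m (phi v)).

(* phi_{L_0, ..., L_{k-2}}(w_0, ..., w_{k-1}) in V[λ_1, ..., λ_n], for w_b in *)
(* V[λ_1, ..., λ_n]: phi is extended linearly over the polynomials by         *)
(* expanding every w_b into monomials, all of which lie in D.                 *)
Definition ev {C : fieldType} {V : lmodType {poly C}} {k n : nat}
    (phi : cmap V k) (L : 'I_k.-1 -> {mpoly C[n]}) (w : 'I_k -> V[λ n]) :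
    V[λ n] :=
  let D := \big[@fsetU _/fset0]_(b < k) lsupp (w b) in
  \sum_(m : {ffun 'I_k -> D})
    lscale (\prod_(b < k) 'X_[val (m b)])
      (lsubst L (phi [tuple lcoef (val (m b)) (w b) | b < k])).

(* With j counted from 0, the j-th summand inserts rho_l at v_j, ...,         *)
(* v_{j+l-1}.  For j = k - 1 no subscript of rho_k has index j.               *)
Definition Ainf_relation {C : fieldType} {V : gradedModType C}
    (rho : forall k, cmap V k) (n : nat) : Prop :=
  forall (v : n.-tuple V) (d : 'I_n -> int),
    (forall a, in_degree (d a) (tnth v a)) ->
    \sum_(1 <= k < n.+1) \sum_(1 <= l < n.+1 | (k + l == n.+1)%N)
    \sum_(j < k)
      ev (rho k)
        (fun a : 'I_k.-1 =>
           if (a < j)%N then lam n.-1 a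
           else if a == j :> nat then \sum_(j <= b < j + l) lam n.-1 b
           else lam n.-1 (a + l.-1))
        (fun a : 'I_k =>
           if (a < j)%N then cst n.-1 v`_a
           else if a == j then
             ev (rho l) (fun b : 'I_l.-1 => lam n.-1 (j + b))
                        (fun b : 'I_l => cst n.-1 v`_(j + b))
           else cst n.-1 v`_(a + l.-1))
      *~ (-1) ^+ absz (\sum_(a < n | (a < j)%N) d a) = 0.

Definition Ainf_conformal {C : fieldType} {V : gradedModType C}
    (rho : forall k, cmap V k) : Prop :=
  (forall k, (0 < k)%N ->
     conformal_sesquilinear (rho k) /\ has_degree (- 1) (rho k)) /\
  (forall n, (0 < n)%N -> Ainf_relation rho n).

(* An A_oo[1]-conformal structure on the complex (V, rho1), where V[] = V.    *)
Definition Ainf_conformal_on {C : fieldType} {V : gradedModType C}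
    (rho1 : V -> V) (rho : forall k, cmap V k) : Prop :=
  Ainf_conformal rho /\ forall v : V, rho 1%N [tuple v] = cst 0 (rho1 v).

Definition lin_degree {C : fieldType} {V W : gradedModType C} (e : int)
    (f : V -> W) : Prop :=
  forall (d : int) (v : V), in_degree d v -> in_degree (d + e) (f v).

Definition chain_complex {C : fieldType} {V : gradedModType C}
    (rho1 : {linear V -> V}) : Prop :=
  lin_degree (- 1) rho1 /\ forall v, rho1 (rho1 v) = 0.

Definition contraction {C : fieldType} {V W : gradedModType C}
    (rho1 : {linear V -> V}) (theta1 : {linear W -> W})
    (p : {linear V -> W}) (i : {linear W -> V}) (h : {linear V -> V}) : Prop :=
  [/\ lin_degree 0 p /\ forall v, p (rho1 v) = theta1 (p v),
      lin_degree 0 i /\ forall w, i (theta1 w) = rho1 (i w),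
      lin_degree 1 h,
      forall v, i (p v) - v = rho1 (h v) + h (rho1 v)
    & forall w, p (i w) = w].

(* Rooted planar trees; [Node f] is the grafting f 0 \/ ... \/ f (l+1), so    *)
(* that isomorphic planar trees are equal.                                    *)
Inductive ptree : Type :=
  Leaf | Node (l : nat) of {ffun 'I_l.+2 -> ptree}.

Fixpoint leaves (T : ptree) : nat :=
  if T is Node l f then (\sum_(j < l.+2) leaves (f j))%N else 1%N.

Definition is_leaf (T : ptree) : bool := if T is Leaf then true else false.

Lemma ptree_ind' (P : ptree -> Prop) :
  P Leaf -> (forall l (f : {ffun 'I_l.+2 -> ptree}), (forall j, P (f j)) -> P (Node f)) ->
  forall T, P T.
Proof.
move=> P0 PN; fix IH 1 => -[|l f]; first exact: P0.
by apply: PN => j; exact: IH.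
Qed.

Fixpoint ptree_enc (T : ptree) : GenTree.tree unit :=
  if T is Node l f then
    GenTree.Node l [seq ptree_enc (f j) | j <- enum 'I_l.+2]
  else GenTree.Leaf tt.

Fixpoint ptree_dec (t : GenTree.tree unit) : ptree :=
  if t is GenTree.Node l s then
    Node [ffun j : 'I_l.+2 => nth Leaf (map ptree_dec s) j]
  else Leaf.

Lemma ptree_encK : cancel ptree_enc ptree_dec.
Proof.
elim/ptree_ind' => //= l f IH; congr Node; apply/ffunP => j; rewrite ffunE.
rewrite -map_comp (nth_map j) ?size_enum_ord //= nth_ord_enum; exact: IH.
Qed.

HB.instance Definition _ := Countable.copy ptree (can_type ptree_encK).

Definition node_in (s : seq ptree) (l : nat)
    (g : {ffun 'I_l.+2 -> seq_sub s}) : ptree :=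
  Node [ffun j => val (g j)].

(* Trees of height < n whose vertices have at most n + 1 inputs.              *)
Fixpoint ptree_enum (n : nat) : seq ptree :=
  if n is n'.+1 then
    Leaf :: [seq node_in g
            | l <- iota 0 n,
              g <- enum {: {ffun 'I_l.+2 -> seq_sub (ptree_enum n')}}]
  else [::].

Definition trees (k : nat) : seq ptree :=
  [seq T <- ptree_enum k | leaves T == k].

Lemma leaves_gt0 T : (0 < leaves T)%N.
Proof.
elim/ptree_ind': T => //= l f IH.
by rewrite big_ord_recl addn_gt0 IH.
Qed.

Lemma leaves_child l (f : {ffun 'I_l.+2 -> ptree}) (j : 'I_l.+2) :
  (leaves (f j) < leaves (Node f))%N.
Proof.
rewrite /= (bigD1 j) //= -[X in (X < _)%N]addn0 ltn_add2l.
pose i : 'I_l.+2 := if j == ord0 then ord_max else ord0.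
rewrite (bigD1 i) /=; first by rewrite addn_gt0 leaves_gt0.
by rewrite /i; case: (j =P ord0) => [->|/eqP]; rewrite 1?eq_sym.
Qed.

Lemma leaves_arity l (f : {ffun 'I_l.+2 -> ptree}) :
  (l.+2 <= leaves (Node f))%N.
Proof.
rewrite /= -[X in (X <= _)%N]card_ord -sum1_card.
by apply: leq_sum => j _; exact: leaves_gt0.
Qed.

Lemma mem_ptree_enum n T : (leaves T <= n)%N -> T \in ptree_enum n.
Proof.
elim: n T => [|n IH] [|l f] le_n //.
- by have := leaves_gt0 (Node f); rewrite ltnNge le_n.
rewrite in_cons; apply/orP; right.
have fP j : f j \in ptree_enum n.
  by apply: IH; rewrite -ltnS (leq_trans (leaves_child f j)).
have -> : Node f = node_in [ffun j => SeqSub (fP j)].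
  by congr Node; apply/ffunP => j; rewrite !ffunE.
apply: allpairs_f_dep; last by rewrite mem_enum.
by rewrite mem_iota add0n; apply: ltnW; exact: leq_trans (leaves_arity f) le_n.
Qed.

Lemma ptree_enum_uniq n : uniq (ptree_enum n).
Proof.
case: n => [//|n]; rewrite /ptree_enum -/ptree_enum cons_uniq; apply/andP; split.
  by apply/negP => /allpairsPdep[l [g [_ _]]].
apply: allpairs_uniq_dep; [exact: iota_uniq | by move=> l _; exact: enum_uniq |].
move=> [l g] [l' g'] _ _ /= E.
have ell : l = l' by case: E.
subst l'; congr existT.
have E' : [ffun j => val (g j)] = [ffun j => val (g' j)] :> {ffun 'I_l.+2 -> ptree}.
  move/(congr1 (fun T => if T is Node m f return {ffun 'I_l.+2 -> ptree}
    then [ffun j : 'I_l.+2 => f (inord j)] else [ffun => Leaf])): E => /ffunP E.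
  by apply/ffunP => j; have := E j; rewrite !ffunE inord_val.
apply/ffunP => j; apply: val_inj.
by move/ffunP/(_ j): E'; rewrite !ffunE.
Qed.

Lemma mem_trees k T : (T \in trees k) = (leaves T == k).
Proof.
rewrite mem_filter andb_idr // => /eqP <-; exact: mem_ptree_enum.
Qed.

Lemma trees_uniq k : uniq (trees k).
Proof. exact/filter_uniq/ptree_enum_uniq. Qed.

(* mu(phi_0 (x) ... (x) phi_{l-1}): the j-th block consists of the indices b  *)
(* with off j <= b < off j.+1.                                                *)
Definition block_comp {C : fieldType} {V : lmodType {poly C}} {l : nat}
    (mu : cmap V l) {ks : 'I_l -> nat} (phi : forall j, cmap V (ks j)) :
    cmap V (\sum_(j < l) ks j)%N :=
  fun v =>
    let n := (\sum_(j < l) ks j)%N.-1 in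
    let off (j : nat) := (\sum_(i < l | i < j) ks i)%N in
    ev mu (fun a : 'I_l.-1 => \sum_(off a <= b < off a.+1) lam n b)
      (fun j : 'I_l =>
         ev (phi j) (fun b : 'I_(ks j).-1 => lam n (off j + b))
                    (fun b : 'I_(ks j) => cst n v`_(off j + b))).

(* [rho_tree] takes the value id at the trivial tree, where [h_rho] does not  *)
(* apply h; this is the convention that h o rho_| = id.                       *)
Definition h_rho {C : fieldType} {V : lmodType {poly C}} (h : V -> V)
    (T : ptree) (phi : cmap V (leaves T)) : cmap V (leaves T) :=
  if is_leaf T then phi else fun v => coefmap h (phi v).

Fixpoint rho_tree {C : fieldType} {V : lmodType {poly C}}
    (rho : forall k, cmap V k) (h : V -> V) (T : ptree) : cmap V (leaves T) :=
  match T return cmap V (leaves T) with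
  | Leaf => fun v => cst 0 (thead v)
  | Node l f =>
      block_comp (rho l.+2) (fun j => h_rho h (@rho_tree C V rho h (f j)))
  end.

Arguments rho_tree {C V} rho h T _.

(* Evaluating rho_T at λ_1, ..., λ_{k-1} and v_1, ..., v_k only serves to     *)
(* transport it along leaves T = k.                                           *)
Definition tree_sum {C : fieldType} {V : lmodType {poly C}}
    (rho : forall k, cmap V k) (h : V -> V) (k : nat) : cmap V k :=
  fun v => \sum_(T <- trees k)
    ev (rho_tree rho h T) (fun a : 'I_(leaves T).-1 => lam k.-1 a)
       (fun b : 'I_(leaves T) => cst k.-1 v`_b).

Definition transfer {C : fieldType} {V W : gradedModType C}
    (theta1 : W -> W) (p : V -> W) (i : W -> V) (h : V -> V)
    (rho : forall k, cmap V k) (k : nat) : cmap W k :=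
  fun w => if k == 1%N then cst k.-1 (theta1 w`_0)
           else coefmap p (tree_sum rho h [tuple of map i w]).

(* Main.v *)
(** Conformal maps are evaluated at points z of C^(k-1): a polynomial in the
    λ's with coefficients in V is determined by its values, and its
    coefficients are linear combinations of these values.  A map
    V^k -> V[λ_1, ..., λ_(k-1)] thus becomes a function on words with letters
    (v, (z, d)), where z is the value of the variable attached to v and d is
    the degree of v; composition substitutes a block by one letter which
    carries the sums of the z's and of the d's of the block, so that an
    A_oo[1]-conformal algebra is an A_oo[1]-algebra of functions on words.

    Let M be the structure on V, mu its part of arity >= 2, and let Φ be the
    sum of h o ρ_T o i over all trees T (with Φ = i on letters).  Grouping the
    trees by their root gives Φ = i + h mu(Φ), and θ = θ_1 + p mu(Φ).  The
    relation for M, applied to the letters Φ(block), reads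
    ρ_1 mu(Φ) + mu(Φ, ..., M(Φ), ..., Φ) = 0.  By induction on the length of
    the word M(Φ) = Φ(θ) on proper blocks, hence
    ρ_1 mu(Φ) + mu(Φ)(θ) = 0 on the whole word; applying h yields M(Φ) = Φ(θ)
    there, and applying p yields the relation for θ. *)
Require Import Defs.
From HB Require Import structures.
From mathcomp Require Import all_boot all_order all_algebra finmap.
From mathcomp Require Import reals complex.
From mathcomp Require Import mpoly zify.

Set Implicit Arguments.
Unset Strict Implicit.
Unset Printing Implicit Defensive.

Import GRing.Theory Num.Theory.

Local Open Scope ring_scope.

(** * Splittings and compositions of words *)

Definition splits (T : Type) (w : seq T) : seq (seq T * seq T) :=
  [seq (take j w, drop j w) | j <- iota 0 (size w).+1].

Lemma splits_cons T (x : T) (w : seq T) :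
  splits (x :: w) = ([::], x :: w) :: [seq (x :: p.1, p.2) | p <- splits w].
Proof.
rewrite /splits -map_comp /= take0 drop0; congr (_ :: _ :: _).
by rewrite -[2%N]/(1 + 1)%N iotaDl -map_comp.
Qed.

Section Compositions.
Variable A : Type.
Implicit Types (w a b : seq A) (c : seq (seq A)).

(** Deleting the first letter of a composition of [x :: w] leaves a composition [c] of [w]; these
    are the compositions that leave [c]. *)
Definition comp_grow x c : seq (seq (seq A)) :=
  ([:: x] :: c) :: (if c is b :: c' then [:: (x :: b) :: c'] else [::]).

(* The compositions of a word, i.e. its decompositions into nonempty blocks.  *)
Fixpoint comps w : seq (seq (seq A)) :=
  if w is x :: w' then flatten [seq comp_grow x c | c <- comps w'] else [:: [::]].

Lemma comps_cons x w : comps (x :: w) = flatten [seq comp_grow x c | c <- comps w].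
Proof. by []. Qed.

Variable Z : nmodType.

Lemma big_splits_nil T (f : seq T -> seq T -> Z) :
  \sum_(p <- splits [::]) f p.1 p.2 = f [::] [::].
Proof. by rewrite big_seq1. Qed.

Lemma big_splits_cons T x (w : seq T) (f : seq T -> seq T -> Z) :
  \sum_(p <- splits (x :: w)) f p.1 p.2 =
  f [::] (x :: w) + \sum_(p <- splits w) f (x :: p.1) p.2.
Proof. by rewrite splits_cons big_cons big_map. Qed.

(** Coassociativity of deconcatenation: both sides run over the cuts of [w] into three parts. *)
Lemma splits_assoc T (w : seq T) (f : seq T -> seq T -> seq T -> Z) :
  \sum_(p <- splits w) \sum_(q <- splits p.1) f q.1 q.2 p.2 =
  \sum_(p <- splits w) \sum_(q <- splits p.2) f p.1 q.1 q.2.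
Proof.
elim: w f => [|x w IH] f.
  by rewrite !big_seq1.
rewrite (big_splits_cons _ _ (fun u v => \sum_(q <- splits u) f q.1 q.2 v)).
rewrite (big_splits_cons _ _ (fun u v => \sum_(q <- splits v) f u q.1 q.2)).
rewrite (big_splits_nil (fun u v => f u v _)).
rewrite (big_splits_cons _ _ (fun u v => f [::] u v)) -addrA -(IH (fun u v =>
  f (x :: u) v)).
congr (_ + _); rewrite -big_split; apply: eq_bigr => p _ /=.
by rewrite (big_splits_cons _ _ (fun u v => f u v p.2)).
Qed.

Lemma big_comps_cons x w (F : seq (seq A) -> Z) :
  \sum_(c <- comps (x :: w)) F c =
  \sum_(c <- comps w)
    (F ([:: x] :: c) + (if c is b :: c' then F ((x :: b) :: c') else 0)).
Proof.
rewrite comps_cons big_flatten big_map; apply: eq_bigr => c _.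
by rewrite big_cons; case: c => [|b c]; rewrite ?big_nil ?big_seq1.
Qed.

(** Cutting a composition between blocks is the same as cutting the word and composing each half
    separately. *)
Lemma comps_splits w (f : seq (seq A) -> seq (seq A) -> Z) :
  \sum_(c <- comps w) \sum_(p <- splits c) f p.1 p.2 =
  \sum_(p <- splits w) \sum_(c1 <- comps p.1) \sum_(c2 <- comps p.2) f c1 c2.
Proof.
elim: w f => [|x w IH] f.
  rewrite (big_splits_nil (fun u v => \sum_(c1 <- comps u) \sum_(c2 <- comps v) f c1 c2)).
  by rewrite /= !big_seq1.
rewrite (big_splits_cons _ _ (fun u v => \sum_(c1 <- comps u) \sum_(c2 <- comps v)
  f c1 c2)).
rewrite big_comps_cons [X in _ = X + _]big_seq1.
rewrite [X in _ = X + _]big_comps_cons.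
pose f' c1 c2 := f ([:: x] :: c1) c2 + (if c1 is b :: c' then f ((x :: b) :: c') c2 else 0).
rewrite [X in _ = _ + X](_ : _ = \sum_(c <- comps w) \sum_(p <- splits c) f' p.1 p.2).
  rewrite -big_split; apply: eq_bigr => c _ /=.
  rewrite big_split /= (big_splits_cons _ _ f) -!addrA; congr (_ + _).
  rewrite [RHS]addrCA; congr (_ + _).
  case: c => [|b c]; first by rewrite add0r big_seq1.
  rewrite (big_splits_cons _ _ f); congr (_ + _).
  rewrite (big_splits_cons _ _ (fun u v => if u is b :: c' then f ((x :: b) :: c')
    v else 0)).
  by rewrite add0r.
rewrite IH; apply: eq_bigr => p _; rewrite big_comps_cons; apply: eq_bigr => c1 _.
by rewrite big_split; congr (_ + _); case: c1 => // ; rewrite big1.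
Qed.

Lemma big_comps_nil w (z : Z) :
  \sum_(c <- comps w) (if c is [::] then z else 0) = if w is [::] then z else 0.
Proof.
case: w => [|x w]; first by rewrite big_seq1.
by rewrite big_comps_cons big1 // => -[|b c] _; rewrite addr0.
Qed.

Lemma big_splits_nil_l T (w : seq T) (f : seq T -> Z) :
  \sum_(p <- splits w) (if p.1 is [::] then f p.2 else 0) = f w.
Proof.
case: w => [|x w].
  by rewrite (big_splits_nil (fun u v => if u is [::] then f v else 0)).
rewrite (big_splits_cons _ _ (fun u v => if u is [::] then f v else 0)).
by rewrite big1 ?addr0.
Qed.

Lemma comps_first x b (f : seq (seq A) -> Z) :
  \sum_(c <- comps (x :: b)) f c =
  \sum_(q <- splits b) \sum_(c <- comps q.2) f ((x :: q.1) :: c).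
Proof.
elim: b x f => [|y b IH] x f.
  rewrite (big_splits_nil (fun u v => \sum_(c <- comps v) f ((x :: u) :: c))).
  by rewrite big_comps_cons /= !big_seq1 addr0.
rewrite (big_splits_cons _ _ (fun u v => \sum_(c <- comps v) f ((x :: u) :: c))).
rewrite big_comps_cons big_split; congr (_ + _) => /=.
by rewrite (IH y (fun c => if c is b0 :: c' then f ((x :: b0) :: c') else 0)).
Qed.

(** The letter [x] lies in exactly one block. The parts of this block before and after [x] are [p.2]
    and [q.1], and the rest of the word is composed independently on both sides. *)
Lemma comps_insert a x b (f : seq (seq A) -> Z) :
  \sum_(c <- comps (a ++ x :: b)) f c =
  \sum_(p <- splits a) \sum_(q <- splits b)
  \sum_(c1 <- comps p.1) \sum_(c3 <- comps q.2)
     f (c1 ++ (p.2 ++ x :: q.1) :: c3).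
Proof.
elim: a f => [|y a IH] f.
  rewrite (big_splits_nil (fun u v => \sum_(q <- splits b)
  \sum_(c1 <- comps u) \sum_(c3 <- comps q.2) f (c1 ++ (v ++ x :: q.1) :: c3))).
  by rewrite comps_first; apply: eq_bigr => q _; rewrite big_seq1.
rewrite (big_splits_cons _ _ (fun u v => \sum_(q <- splits b)
  \sum_(c1 <- comps u) \sum_(c3 <- comps q.2) f (c1 ++ (v ++ x :: q.1) :: c3))).
rewrite cat_cons big_comps_cons IH.
(* The terms in which [y] joins the block of [x]. On the left they arise only when no block precedes
   that block, that is, for [p.1] empty. *)
pose g v q := \sum_(c3 <- comps q.2) f ((y :: v ++ x :: q.1) :: c3).
pose G v := \sum_(q <- splits b) g v q.
rewrite [X in _ = X + _](_ : _ = G a); last first.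
  by apply: eq_bigr => q _; rewrite big_seq1.
rewrite -(big_splits_nil_l a G) -big_split; apply: eq_bigr => p _ /=.
rewrite [X in X + _](_ : _ = \sum_(q <- splits b) (if p.1 is [::] then g p.2 q else 0));
  last by case: (p.1) => //; rewrite big1.
rewrite -big_split; apply: eq_bigr => q _ /=.
rewrite -big_comps_nil [X in _ = _ + X]big_comps_cons -big_split.
apply: eq_bigr => -[|b1 c1] _ /=.
  by rewrite addr0 big_split /= addrC.
by rewrite add0r -big_split.
Qed.

End Compositions.

Lemma mem_splits (T : eqType) (w : seq T) p : p \in splits w -> p.1 ++ p.2 = w.
Proof. by case/mapP => j _ ->; rewrite cat_take_drop. Qed.

Lemma map_splits (T T' : Type) (f : T -> T') (w : seq T) :
  splits (map f w) = [seq (map f p.1, map f p.2) | p <- splits w].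
Proof.
rewrite /splits size_map -map_comp; apply: eq_map => j /=.
by rewrite map_take map_drop.
Qed.

Lemma comps_map (A B : Type) (f : A -> B) (w : seq A) :
  comps (map f w) = map (map (map f)) (comps w).
Proof.
elim: w => //= x w ->; rewrite map_flatten -!map_comp; congr flatten.
by apply: eq_map => -[].
Qed.

Lemma mem_comp_grow (A : eqType) (x : A) c d :
  (d \in comp_grow x c) =
  (d == [:: x] :: c) || (if c is b :: c' then d == (x :: b) :: c' else false).
Proof. by rewrite in_cons; case: c => [|b c]; rewrite ?in_nil ?mem_seq1. Qed.

Lemma mem_comps (A : eqType) (w : seq A) c :
  (c \in comps w) = (flatten c == w) && ([::] \notin c).
Proof.
elim: w c => [|x w IH] c.
  by rewrite mem_seq1; case: c => [|[|y b] c] //; rewrite in_cons eqxx andbF.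
rewrite comps_cons; apply/flatten_mapP/idP.
  case=> d; rewrite IH mem_comp_grow => /andP[/eqP <- d0] /orP[/eqP -> /=|].
    by rewrite eqxx.
  case: d d0 => // b d; rewrite in_cons negb_or => /andP[_ d0] /eqP ->.
  by rewrite in_cons negb_or d0 /= eqxx.
case: c => [|[|y [|z b]] c] //; rewrite ?in_cons ?eqxx ?andbF //=.
  case/andP => /eqP[-> Ew] c0.
  by exists c; rewrite ?IH ?Ew ?eqxx // mem_comp_grow eqxx.
case/andP => /eqP[-> Ew] c0.
exists ((z :: b) :: c); first by rewrite IH /= Ew eqxx in_cons.
by rewrite mem_comp_grow eqxx orbT.
Qed.

(** Since blocks are nonempty, a first block [x :: b] differs from [[:: x]], so [c] can be recovered
    from each member of [comp_grow x c]. *)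
Lemma comps_uniq (A : eqType) (w : seq A) : uniq (comps w).
Proof.
elim: w => // x w; rewrite comps_cons.
have: {in comps w, forall c, [::] \notin c} by move=> c; rewrite mem_comps => /andP[].
elim: (comps w) => // c s IH n0 /andP[cs us].
have -> : flatten (map (comp_grow x) (c :: s)) =
  comp_grow x c ++ flatten (map (comp_grow x) s) by [].
rewrite cat_uniq {}IH //; last first.
  by move=> d ds; apply: n0; rewrite in_cons ds orbT.
have c0 := n0 c (mem_head _ _); rewrite andbT; apply/andP; split.
  case: (c) c0 => // b c'; rewrite in_cons negb_or => /andP[b0 _].
  by rewrite cons_uniq mem_seq1 andbT; apply: contraNneq b0 => -[<-].
apply/hasPn => d /flatten_mapP[e es]; rewrite !mem_comp_grow => He.
have e0 : [::] \notin e by apply: n0; rewrite in_cons es orbT.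
have ce : c != e by apply: contraNneq cs => ->.
case/orP: He => [/eqP ->|].
  rewrite negb_or; apply/andP; split; first by apply: contraNneq ce => -[->].
  case: (c) c0 => // b c'; rewrite in_cons negb_or => /andP[b0 _].
  by apply: contraNneq b0 => -[<-].
case: e e0 ce {es} => // b e; rewrite in_cons negb_or => /andP[b0 _] ce /eqP ->.
rewrite negb_or; apply/andP; split; first by apply: contraNneq b0 => -[->].
by case: (c) ce => // b' c'; apply: contraNneq => -[-> ->].
Qed.

(** * Evaluation of the formal variables *)

Section Evaluation.
Variables (C : fieldType) (V : lmodType {poly C}).
Implicit Types (n : nat).

Lemma lcoef_is_additive n (m : 'X_{1..n}) : zmod_morphism (@lcoef C V n m).
Proof. by move=> x y; rewrite !lcoef.unlock monalg.mcoeffB. Qed.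

HB.instance Definition _ n (m : 'X_{1..n}) :=
  GRing.isZmodMorphism.Build V[λ n] V (@lcoef C V n m) (lcoef_is_additive m).

Lemma lmonom_is_additive n (m : 'X_{1..n}) : zmod_morphism (@lmonom C V n m).
Proof. by move=> x y; rewrite !lmonom.unlock monalg.monalgUB. Qed.

HB.instance Definition _ n (m : 'X_{1..n}) :=
  GRing.isZmodMorphism.Build V V[λ n] (@lmonom C V n m) (lmonom_is_additive m).

Lemma lcoef_monom n (m m' : 'X_{1..n}) (v : V) :
  lcoef m' (lmonom m v) = v *+ (m == m').
Proof. by rewrite lcoef.unlock lmonom.unlock monalg.mcoeffU. Qed.

Lemma mem_lsupp n (x : V[λ n]) m : (m \in lsupp x) = (lcoef m x != 0).
Proof. by rewrite lcoef.unlock lsupp.unlock monalg.mcoeff_neq0. Qed.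

Lemma lpolyE n (x : V[λ n]) : x = \sum_(m <- lsupp x) lmonom m (lcoef m x).
Proof.
rewrite lcoef.unlock lmonom.unlock lsupp.unlock; exact: monalg.monalgE.
Qed.

Definition leval n (z : 'I_n -> C) (x : V[λ n]) : V :=
  \sum_(m <- lsupp x) (mmap1 z m)%:P *: lcoef m x.

(** Monomials outside the support have coefficient 0; this lets several polynomials be summed over a
    common set. *)
Lemma leval_wide n (z : 'I_n -> C) (x : V[λ n]) (D : {fset 'X_{1..n}}) :
  {subset lsupp x <= D} ->
  leval z x = \sum_(m <- D) (mmap1 z m)%:P *: lcoef m x.
Proof.
move=> sD; rewrite [RHS](bigID (mem (lsupp x))) /= [X in _ = _ + X]big1 => [|m].
  rewrite addr0 -big_filter; apply: perm_big; apply: uniq_perm.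
  - exact: fset_uniq.
  - exact/filter_uniq/fset_uniq.
  by move=> m; rewrite mem_filter; case: (boolP (m \in lsupp x)) => // /sD ->.
by rewrite mem_lsupp negbK => /eqP ->; rewrite scaler0.
Qed.

Lemma leval_is_additive n (z : 'I_n -> C) : zmod_morphism (leval z).
Proof.
move=> x y; pose D := (lsupp x `|` lsupp y `|` lsupp (x - y))%fset.
rewrite !(@leval_wide _ z _ D) => [|m|m|m];
  try by rewrite !inE => ->; rewrite ?orbT.
by rewrite -sumrB; apply: eq_bigr => m _; rewrite raddfB scalerBr.
Qed.

HB.instance Definition _ n (z : 'I_n -> C) :=
  GRing.isZmodMorphism.Build V[λ n] V (leval z) (leval_is_additive z).

Lemma leval_monom n (z : 'I_n -> C) m v :
  leval z (lmonom m v) = (mmap1 z m)%:P *: v.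
Proof.
rewrite (@leval_wide _ _ _ [fset m]%fset) => [|m'].
  by rewrite big_seq_fset1 lcoef_monom eqxx.
by rewrite mem_lsupp lcoef_monom in_fset1 [m' == m]eq_sym; case: (m == m') => //=;
  rewrite mulr0n eqxx.
Qed.

Lemma leval_cst n (z : 'I_n -> C) v : leval z (cst n v) = v.
Proof. by rewrite leval_monom mmap11 scale1r. Qed.

Lemma leval_lscale n (z : 'I_n -> C) q (x : V[λ n]) :
  leval z (lscale q x) = (q.@[z])%:P *: leval z x.
Proof.
rewrite mevalE rmorph_sum scaler_suml raddf_sum; apply: eq_bigr => m _.
rewrite raddf_sum scaler_sumr; apply: eq_bigr => m' _ /=.
rewrite leval_monom !scalerA -!polyCM commr_mmap1_M => [|j y]; last exact: mulrC.
by rewrite [in LHS]mulrC mulrA.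
Qed.

Lemma leval_lsubst k n (z : 'I_n -> C) (L : 'I_k -> {mpoly C[n]}) (x : V[λ k]) :
  leval z (lsubst L x) = leval (fun a => (L a).@[z]) x.
Proof.
rewrite raddf_sum; apply: eq_bigr => m _ /=.
rewrite leval_lscale leval_cst /mmap1 rmorph_prod; congr (_%:P *: _).
by apply: eq_bigr => j _; rewrite rmorphXn.
Qed.

Lemma leval_ext n (z z' : 'I_n -> C) x : z =1 z' -> leval z x = leval z' x.
Proof. by move=> zz'; apply: eq_bigr => m _; rewrite (mmap1_eq _ zz'). Qed.

End Evaluation.

Lemma leval_coefmap (C : fieldType) (V W : lmodType {poly C}) n (z : 'I_n -> C)
    (f : V -> W) (x : V[λ n]) :
  zmod_morphism f -> (forall c v, f (c%:P *: v) = c%:P *: f v) ->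
  leval z (coefmap f x) = f (leval z x).
Proof.
move=> fB fZ.
pose f_additive := GRing.isZmodMorphism.Build V W f fB.
pose F : {additive V -> W} := HB.pack f f_additive.
rewrite raddf_sum [RHS](raddf_sum F); apply: eq_bigr => m _ /=.
by rewrite leval_monom fZ.
Qed.

(** Uniqueness of base-[N] expansions, by reduction modulo [N]. It separates the monomials on the
    interpolation curve below. *)
Lemma digits_inj n N (f g : 'I_n -> nat) :
  (forall i, f i < N)%N -> (forall i, g i < N)%N ->
  (\sum_i f i * N ^ i)%N = (\sum_i g i * N ^ i)%N -> f =1 g.
Proof.
elim: n f g => [|n IH] f g fN gN; first by move=> _ [].
have N0 : (0 < N)%N by apply: leq_trans (fN ord0).
have E (u : 'I_n.+1 -> nat) : (\sum_i u i * N ^ i)%N =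
    ((\sum_(i < n) u (lift ord0 i) * N ^ i) * N + u ord0)%N.
  rewrite big_ord_recl muln1 addnC big_distrl; congr (_ + _)%N.
  by apply: eq_bigr => i _; rewrite lift0 expnSr mulnA.
rewrite !E => Efg.
have fg0 : f ord0 = g ord0.
  by move/(congr1 (modn^~ N)): Efg; rewrite !modnMDl !modn_small.
move: Efg; rewrite fg0 => /addIn /eqP; rewrite eqn_pmul2r // => /eqP Efg i.
case: (unliftP ord0 i) => [j ->|-> //].
exact: (IH (fun i => f (lift ord0 i)) (fun i => g (lift ord0 i))).
Qed.

(* Lagrange interpolation along the curve z_i = 2^(N^i t), on which distinct  *)
(* monomials of degree < N become distinct powers of 2^t.                     *)
Lemma lcoef_interp (C : numFieldType) (V : lmodType {poly C}) n (x : V[λ n]) m :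
  exists s : seq (C * ('I_n -> C)),
    lcoef m x = \sum_(p <- s) p.1%:P *: leval p.2 x.
Proof.
have [mx|mx] := boolP (m \in lsupp x); last first.
  exists [::]; rewrite big_nil.
  by move: mx; rewrite mem_lsupp negbK => /eqP.
(* A strict bound for all exponents in [x], which thereby become digits in base [N]. *)
pose N := (\max_(m <- lsupp x) mdeg m).+1.
pose e (m : 'X_{1..n}) := (\sum_(i < n) m i * N ^ i)%N.
have ltN m' (i : 'I_n) : m' \in lsupp x -> (m' i < N)%N.
  move=> m'x; rewrite ltnS; apply: (@leq_trans (mdeg m')).
    by rewrite mdegE (bigD1 i) //= leq_addr.
  exact: (@leq_bigmax_seq _ _ xpredT (@mdeg n)).
have e_inj : {in lsupp x &, injective e}.
  move=> m1 m2 m1x m2x /digits_inj E; apply/mnmP; apply: E => i; exact: ltN.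
pose a m' : C := 2 ^+ e m'.
have a_inj : {in lsupp x &, injective a}.
  move=> m1 m2 m1x m2x E; apply: e_inj => //.
  by apply/eqP; rewrite -(eqn_exp2l _ _ (ltnSn 1)) -(eqr_nat C) !natrX; apply/eqP.
(* The Lagrange polynomial that vanishes at the nodes of all monomials of [x] other than [m]. *)
pose q := \prod_(m' <- rem m (lsupp x)) ('X - (a m')%:P).
have qa m' : m' \in lsupp x -> (q.[a m'] == 0) = (m' != m).
  move=> m'x; rewrite horner_prod prodf_seq_eq0; apply/hasP/idP.
    case=> m2; rewrite (mem_rem_uniq _ (fset_uniq _)) inE => /andP[m2m m2x] /=.
    rewrite hornerXsubC subr_eq0 => /eqP /a_inj E.
    by rewrite (E m'x m2x).
  move=> m'm; exists m'; last by rewrite /= hornerXsubC subrr.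
  by rewrite (mem_rem_uniq _ (fset_uniq _)) inE m'm m'x.
(* At the [t]-th point the monomial [m'] takes the value [a m' ^+ t]; weighting by the coefficients
   of [q] therefore produces [q.[a m']], which is nonzero for [m] alone. *)
exists [seq (q`_t / q.[a m], fun i : 'I_n => 2 ^+ (N ^ i * t)) | t <- iota 0 (size q)].
rewrite big_map -/(index_iota 0 _) -[size q]subn0 -/(index_iota 0 _) big_mkord.
have E (t : nat) m' : mmap1 (fun i : 'I_n => 2 ^+ (N ^ i * t) : C) m' = a m' ^+ t.
  rewrite /mmap1 -exprM /e big_distrl /= -prodrXr; apply: eq_bigr => i _.
  by rewrite -exprM; congr (_ ^+ _); rewrite mulnAC (mulnC (N ^ i)%N).
under eq_bigr => t _ do rewrite /leval scaler_sumr.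
rewrite exchange_big /= (big_rem m mx) /= [X in _ = _ + X]big_seq [X in _ = _ +
  X]big1 => [|m'].
  rewrite addr0; under eq_bigr => t _ do rewrite E scalerA -polyCM mulrAC.
  rewrite -scaler_suml -rmorph_sum -mulr_suml -horner_coef divff ?scale1r //.
  by rewrite qa // negbK.
rewrite (mem_rem_uniq _ (fset_uniq _)) inE => /andP[m'm m'x].
under eq_bigr => t _ do rewrite E scalerA -polyCM mulrAC.
rewrite -scaler_suml -rmorph_sum -mulr_suml -horner_coef.
by have /eqP -> : q.[a m'] == 0; rewrite ?qa // mul0r scale0r.
Qed.

Lemma leval_inj (C : numFieldType) (V : lmodType {poly C}) n (x y : V[λ n]) :
  (forall z, leval z x = leval z y) -> x = y.
Proof.
move=> E; apply/eqP; rewrite -subr_eq0; apply/eqP.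
rewrite [LHS]lpolyE big1 // => m _.
have [s ->] := lcoef_interp (x - y) m.
by rewrite big1 ?raddf0 // => p _; rewrite raddfB /= E subrr scaler0.
Qed.

(** * Homogeneity of a polynomial and of its values *)

Section Degrees.
Variables (C : fieldType) (V : gradedModType C) (d : int).

Lemma in_degreeD (u v : V) : in_degree d u -> in_degree d v -> in_degree d (u + v).
Proof. by move=> du dv; rewrite -[u]scale1r; apply: in_degreeP. Qed.

Lemma in_degreeZ (a : {poly C}) (u : V) : in_degree d u -> in_degree d (a *: u).
Proof. by move=> du; rewrite -[_ *: _]addr0; apply: in_degreeP => //;
  apply: in_degree0. Qed.

Lemma in_degree_sum (I : Type) (s : seq I) (P : pred I) (F : I -> V) :
  (forall i, P i -> in_degree d (F i)) -> in_degree d (\sum_(i <- s | P i) F i).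
Proof. by move=> dF; apply: big_ind => //; [exact: in_degree0 | exact: in_degreeD]. Qed.

Lemma in_degree_leval n (z : 'I_n -> C) (x : V[λ n]) :
  (forall m, in_degree d (lcoef m x)) -> in_degree d (leval z x).
Proof. by move=> dx; apply: in_degree_sum => m _; apply: in_degreeZ. Qed.

End Degrees.

Lemma in_degree_lcoef (C : numFieldType) (V : gradedModType C) d n (x : V[λ n]) :
  (forall z, in_degree d (leval z x)) -> forall m, in_degree d (lcoef m x).
Proof.
move=> dx m; have [s ->] := lcoef_interp x m.
by apply: in_degree_sum => p _; apply: in_degreeZ.
Qed.

(** * Conformal maps as functions on words *)

Notation letter C V := (V * (C * int))%type.

Section Words.
Variables (C : fieldType) (V : lmodType {poly C}).
Implicit Types (a b w : seq (letter C V)).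

Definition word_total (U : Type) (w : seq (letter C U)) : C * int := \sum_(x <- w) x.2.

Lemma word_total_cat (U : Type) (w1 w2 : seq (letter C U)) :
  word_total (w1 ++ w2) = word_total w1 + word_total w2.
Proof. exact: big_cat. Qed.

Lemma word_total_cons (U : Type) (x : letter C U) (w : seq (letter C U)) :
  word_total (x :: w) = x.2 + word_total w.
Proof. exact: big_cons. Qed.

(* A letter (v, (z, d)) carries the value z of the formal variable attached   *)
(* to v and the degree d of v; phi ignores the degrees, and the value z of    *)
(* the last letter.                                                           *)
Definition word_eval k (phi : cmap V k) w : V :=
  leval (fun i : 'I_k.-1 => (w`_i).2.1) (phi [tuple (w`_i).1 | i < k]).

Definition word_linear (U : lmodType {poly C}) k (F : seq (letter C V) -> U) :=
  forall a b g c x y, (size a + size b).+1 = k ->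
    F (a ++ (c%:P *: x + y, g) :: b) =
    c%:P *: F (a ++ (x, g) :: b) + F (a ++ (y, g) :: b).

(** Both sesquilinearity rules in one formula: a letter (∂ + z)x gives 0 unless it is the last one,
    where ∂ + z comes out as ∂ plus the sum of all the z's. The last letter's z, which a conformal
    map ignores, is added on both sides to make this uniform. *)
Definition word_sesqui (U : lmodType {poly C}) k (F : seq (letter C V) -> U) :=
  forall a b x z d, (size a + size b).+1 = k ->
    F (a ++ ('X *: x + z%:P *: x, (z, d)) :: b) =
    if b is [::] then
      ('X + (word_total (a ++ (x, (z, d)) :: b)).1%:P) *: F (a ++ (x, (z, d)) :: b)
    else 0.

Lemma leval_word k (phi : cmap V k) (z : 'I_k.-1 -> C) v w :
  (forall i : 'I_k, (w`_i).1 = tnth v i) ->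
  (forall i : 'I_k.-1, (w`_i).2.1 = z i) ->
  leval z (phi v) = word_eval phi w.
Proof.
move=> wv wz; rewrite /word_eval; have -> : [tuple (w`_i).1 | i < k] = v.
  by apply: eq_from_tnth => i; rewrite tnth_mktuple wv.
by apply: leval_ext => i; rewrite wz.
Qed.

(** The last letter has no formal variable and gets the default value 0; the degrees are set to 0
    because [word_eval] ignores them. *)
Definition tuple_word k (z : 'I_k.-1 -> C) (v : k.-tuple V) : seq (letter C V) :=
  [seq (tnth v i, (if insub (val i) is Some j then z j else 0, 0)) | i <- enum 'I_k].

Lemma size_tuple_word k (z : 'I_k.-1 -> C) (v : k.-tuple V) :
  size (tuple_word z v) = k.
Proof. by rewrite size_map size_enum_ord. Qed.

Lemma nth_tuple_word k (z : 'I_k.-1 -> C) (v : k.-tuple V) (i : 'I_k) :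
  (tuple_word z v)`_i = (tnth v i, (if insub (val i) is Some j then z j else 0, 0)).
Proof. by rewrite (nth_map i) ?size_enum_ord // nth_ord_enum. Qed.

Lemma tuple_wordE k (phi : cmap V k) (z : 'I_k.-1 -> C) (v : k.-tuple V) :
  leval z (phi v) = word_eval phi (tuple_word z v).
Proof.
apply: leval_word => i; first by rewrite nth_tuple_word.
have ik : (i < k)%N by apply: leq_trans (ltn_ord i) (leq_pred k).
by rewrite (nth_tuple_word z v (Ordinal ik)) /= valK.
Qed.

Lemma tnth_upd k (v : k.-tuple V) (j i : 'I_k) x :
  tnth (upd v j x) i = if i == j then x else tnth v i.
Proof. exact: tnth_mktuple. Qed.

Lemma tuple_word_upd k (z : 'I_k.-1 -> C) (v : k.-tuple V) (j : 'I_k) x :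
  tuple_word z (upd v j x) =
  take j (tuple_word z v) ++
  (x, ((tuple_word z v)`_j).2) :: drop j.+1 (tuple_word z v).
Proof.
have sz : size (take j (tuple_word z v)) = j.
  by rewrite size_takel // size_tuple_word ltnW.
apply: (@eq_from_nth _ 0) => [|m].
  by rewrite size_cat /= size_drop sz !size_tuple_word addnS -addSn subnKC.
rewrite size_tuple_word => mk.
rewrite [LHS](nth_tuple_word z _ (Ordinal mk)) tnth_upd nth_cat sz -val_eqE /=.
have /= E := nth_tuple_word z v (Ordinal mk).
case: ltngtP => mj; first by rewrite nth_take // E.
  by rewrite -(subnSK mj) /= nth_drop subnKC // E.
by rewrite mj subnn /= -mj E.
Qed.

Lemma tuple_word_split k (z : 'I_k.-1 -> C) (v : k.-tuple V) (j : 'I_k) :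
  tuple_word z v = take j (tuple_word z v) ++
    (tnth v j, ((tuple_word z v)`_j).2) :: drop j.+1 (tuple_word z v).
Proof.
rewrite -[LHS](cat_take_drop j) (drop_nth 0) ?size_tuple_word //.
by rewrite nth_tuple_word.
Qed.

Lemma size_tuple_word_split k (z : 'I_k.-1 -> C) (v : k.-tuple V) (j : 'I_k) :
  (size (take j (tuple_word z v)) + size (drop j.+1 (tuple_word z v))).+1 = k.
Proof.
by rewrite size_take size_drop size_tuple_word ltn_ord -addSn subnKC.
Qed.

(** Words that differ in one letter become updates of a single tuple, whatever the reference letter
    [y]; this is the form in which [multilinear] is stated. *)
Lemma word_eval_upd k (phi : cmap V k) a b x y g (j : 'I_k) :
  j = size a :> nat ->
  word_eval phi (a ++ (x, g) :: b) =
  leval (fun i : 'I_k.-1 => ((a ++ (y, g) :: b)`_i).2.1)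
    (phi (upd [tuple ((a ++ (y, g) :: b)`_i).1 | i < k] j x)).
Proof.
move=> ja; rewrite (leval_word _ (w := a ++ (x, g) :: b)) // => i.
  rewrite tnth_upd tnth_mktuple -val_eqE /= ja !nth_cat; case: ltngtP => // [ia|->].
    by rewrite -(subnSK ia).
  by rewrite subnn.
by rewrite !nth_cat; case: ltngtP => // [ia|->]; rewrite ?subnn // -(subnSK ia).
Qed.

Lemma word_eval_linear k (phi : cmap V k) :
  multilinear phi -> word_linear k (word_eval phi).
Proof.
move=> lin a b g c x y sk.
have ak : (size a < k)%N by rewrite -sk ltnS leq_addr.
rewrite !(@word_eval_upd _ phi a b _ 0 g (Ordinal ak)) // lin raddfD /=.
congr (_ + _); rewrite leval_coefmap // => [u v|e v]; first exact: scalerBr.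
by rewrite !scalerA mulrC.
Qed.

Lemma scaleC_additive (c : {poly C}) : zmod_morphism (fun v : V => c *: v).
Proof. by move=> u v; exact: scalerBr. Qed.

Lemma scaleC_comm (c : {poly C}) (e : C) (v : V) : c *: (e%:P *: v) = e%:P *: (c *: v).
Proof. by rewrite !scalerA mulrC. Qed.

Lemma meval_lam n (z : 'I_n -> C) i :
  (lam n i).@[z] = if insub i is Some j then z j else 0.
Proof. by rewrite /lam; case: insubP => [j _ _|_]; rewrite ?mevalXU ?meval0. Qed.

Lemma word_eval_sesqui k (phi : cmap V k) :
  conformal_sesquilinear phi -> word_sesqui k (word_eval phi).
Proof.
case=> lin sesq last a b x z d sk.
have ak : (size a < k)%N by rewrite -sk ltnS leq_addr.
pose j := Ordinal ak.
rewrite -[_ + _]addrC word_eval_linear //.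
rewrite (@word_eval_upd _ phi a b ('X *: x) x _ j) //.
set v := [tuple _ | i < k].
have vj : tnth v j = x by rewrite tnth_mktuple nth_cat ltnn subnn.
set zf := (X in leval X _).
have E : leval zf (phi v) = word_eval phi (a ++ (x, (z, d)) :: b) by [].
have {1}-> : 'X *: x = 'X *: tnth v j by rewrite vj.
case: b @v vj @zf E sk => [|y b] v vj zf E sk.
  have sk1 : k.-1 = size a by rewrite -sk addn0.
  rewrite last /= ?sk1 //.
  rewrite raddfD /= leval_lscale leval_coefmap; last exact: scaleC_comm.
    rewrite E addrCA -!scalerDl; congr (_ *: _); rewrite -polyCD.
    congr (_ + _%:P); rewrite raddf_sum /= word_total_cat word_total_cons addrC /=.
    rewrite /word_total big_nil addr0 /= addrC.
    rewrite [LHS]addrC; congr (_ + _).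
    rewrite raddf_sum /= (big_nth 0) -{1}sk1 big_mkord; apply: eq_bigr => i _.
    by rewrite meval_lam valK /zf nth_cat -sk1 ltn_ord.
  exact: scaleC_additive.
have jk : (j < k.-1)%N by rewrite ltn_predRL -[X in (_ < X)%N]sk /= addnS !ltnS leq_addr.
rewrite sesq // raddfN /= leval_lscale meval_lam insubT E /zf /= nth_cat ltnn subnn.
by rewrite subrr.
Qed.

End Words.

(** * From functions on words back to conformal maps *)

Section WordsToMaps.
Variables (C : numFieldType) (V : lmodType {poly C}).

Lemma multilinear_of_words k (phi : cmap V k) :
  word_linear k (word_eval phi) -> multilinear phi.
Proof.
move=> lin v j c x y; apply: leval_inj => z; rewrite raddfD /=.
rewrite leval_coefmap; [|exact: scaleC_additive|exact: scaleC_comm].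
by rewrite !tuple_wordE !tuple_word_upd lin // size_tuple_word_split.
Qed.

Lemma sesquilinear_of_words k (phi : cmap V k) :
  word_linear k (word_eval phi) -> word_sesqui k (word_eval phi) ->
  conformal_sesquilinear phi.
Proof.
move=> lin sesq; split; first exact: multilinear_of_words.
  move=> v j jk; apply: leval_inj => z; rewrite raddfN /= leval_lscale meval_lam.
  rewrite insubT !tuple_wordE tuple_word_upd [in RHS](tuple_word_split _ _ j).
  set a := take _ _; set b := drop _ _; rewrite nth_tuple_word insubT /=.
  set zj := z _.
  have sk : (size a + size b).+1 = k := size_tuple_word_split z v j.
  have := sesq a b (tnth v j) zj 0 sk.
  have : b != [::].
    by rewrite -size_eq0 size_drop size_tuple_word subn_eq0 -ltnNge -ltn_predRL.
  case: b sk => // y b sk _; rewrite addrC lin //.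
  by move/eqP; rewrite addrC addr_eq0 => /eqP ->.
move=> v j jk; apply: leval_inj => z; rewrite raddfD /= leval_lscale.
rewrite leval_coefmap; [|exact: scaleC_additive|exact: scaleC_comm].
rewrite !tuple_wordE tuple_word_upd -scalerDl.
rewrite [in RHS](tuple_word_split _ _ j).
have := size_tuple_word_split z v j.
have -> : drop j.+1 (tuple_word z v) = [::].
  by rewrite drop_oversize // size_tuple_word jk; case: (k) j {jk} => // - [].
set a := take _ _; rewrite nth_tuple_word insubF /=; last by rewrite jk ltnn.
(* The last letter carries z = 0, so the extra term disappears and the total is the sum of the
   remaining variables. *)
move=> sk; have := sesq a [::] (tnth v j) 0 0 sk.
rewrite scale0r addr0 => ->; congr ((_ + _%:P) *: _).
rewrite word_total_cat word_total_cons {2}/word_total big_nil /= !addr0 !raddf_sum /=.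
have sa : size a = k.-1 by rewrite -jk size_takel // size_tuple_word ltnW.
rewrite (big_nth 0) sa big_mkord; apply: eq_bigr => i _.
rewrite nth_take ?jk // meval_lam valK.
have ik : (i < k)%N by apply: leq_trans (ltn_ord i) (leq_pred k).
by rewrite (nth_tuple_word z v (Ordinal ik)) /= valK.
Qed.

End WordsToMaps.

Lemma map_enum_ordS (T : Type) n (f : 'I_n.+1 -> T) :
  [seq f j | j <- enum 'I_n.+1] =
  f ord0 :: [seq f (lift ord0 j) | j <- enum 'I_n].
Proof. by rewrite enum_ordSl /= -map_comp. Qed.

(** * Expansion of multilinear functions on words *)

Section Multilinearity.
Variables (C : fieldType) (V U : lmodType {poly C}) (k : nat).
Variable F : seq (letter C V) -> U.
Hypothesis linF : word_linear k F.
Implicit Types (a b w : seq (letter C V)).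

Lemma word_linear0 a b g : (size a + size b).+1 = k -> F (a ++ (0, g) :: b) = 0.
Proof.
move=> sk; have := linF g 1 0 0 sk; rewrite !scale1r addr0 => /esym/eqP.
by rewrite -subr_eq0 addrK => /eqP.
Qed.

Lemma word_linearD a b g x y : (size a + size b).+1 = k ->
  F (a ++ (x + y, g) :: b) = F (a ++ (x, g) :: b) + F (a ++ (y, g) :: b).
Proof. by move=> sk; have := linF g 1 x y sk; rewrite !scale1r. Qed.

Lemma word_linearZ a b g (c : C) x : (size a + size b).+1 = k ->
  F (a ++ (c%:P *: x, g) :: b) = c%:P *: F (a ++ (x, g) :: b).
Proof. by move=> sk; have := linF g c x 0 sk; rewrite word_linear0 // !addr0. Qed.

Lemma word_linear_sum a b g (I : Type) (s : seq I) (P : pred I) (x : I -> V) :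
  (size a + size b).+1 = k ->
  F (a ++ (\sum_(i <- s | P i) x i, g) :: b) =
  \sum_(i <- s | P i) F (a ++ (x i, g) :: b).
Proof.
move=> sk; apply: (big_morph (fun y => F (a ++ (y, g) :: b))).
  by move=> y z; exact: word_linearD.
exact: word_linear0.
Qed.

Lemma word_linear_sign a b g x (e : int) : (size a + size b).+1 = k ->
  F (a ++ (x *~ e, g) :: b) = F (a ++ (x, g) :: b) *~ e.
Proof.
move=> sk; rewrite -[x *~ e]scale1r -scaler_int scalerA mul1r.
have -> : e%:~R = (e%:~R : C)%:P by rewrite rmorph_int.
by rewrite word_linearZ // rmorph_int scaler_int.
Qed.

(** The prefix [a], here and in the next lemma, serves the induction: letters already treated move
    into it one at a time. *)
Lemma word_linear_prodZ n a (c : 'I_n -> C) (x : 'I_n -> V) g :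
  (size a + n = k)%N ->
  F (a ++ [seq ((c j)%:P *: x j, g j) | j <- enum 'I_n]) =
  (\prod_j c j)%:P *: F (a ++ [seq (x j, g j) | j <- enum 'I_n]).
Proof.
elim: n a c x g => [|n IH] a c x g sk.
  by rewrite big_ord0 scale1r; have -> : enum 'I_0 = [::] by apply: size0nil;
    rewrite size_enum_ord.
rewrite !map_enum_ordS word_linearZ; last first.
  by rewrite size_map size_enum_ord -sk addnS.
rewrite -!cat_rcons.
have /= -> := IH (rcons a (x ord0, g ord0)) (fun j => c (lift ord0 j))
  (fun j => x (lift ord0 j)) (fun j => g (lift ord0 j)).
  by rewrite scalerA -polyCM big_ord_recl.
by rewrite size_rcons -sk addnS.
Qed.

Lemma word_linear_bigA n a (T : finType) (P : 'I_n -> pred T)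
    (x : 'I_n -> T -> V) g :
  (size a + n = k)%N ->
  F (a ++ [seq (\sum_(t | P j t) x j t, g j) | j <- enum 'I_n]) =
  \sum_(f : {ffun 'I_n -> T} | [forall j, P j (f j)])
    F (a ++ [seq (x j (f j), g j) | j <- enum 'I_n]).
Proof.
elim: n a P x g => [|n IH] a P x g sk.
  have e0 : enum 'I_0 = [::] by apply: size0nil; rewrite size_enum_ord.
  have f0 : {ffun 'I_0 -> T} by apply: finfun; case.
  rewrite (big_pred1 f0) ?e0 // => f; have -> : f = f0 by apply/ffunP; case.
  by rewrite /= eqxx; apply/forallP; case.
rewrite map_enum_ordS word_linear_sum; last first.
  by rewrite size_map size_enum_ord -sk addnS.
(* [c] and [d] are the mutually inverse bijections between a function on ['I_n.+1] and the pair of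
   its value at 0 and its other values. *)
pose c (p : T * {ffun 'I_n -> T}) : {ffun 'I_n.+1 -> T} :=
  [ffun j => if unlift ord0 j is Some i then p.2 i else p.1].
pose d (f : {ffun 'I_n.+1 -> T}) := (f ord0, [ffun j => f (lift ord0 j)]).
have c0 p : c p ord0 = p.1 by rewrite ffunE unlift_none.
have cl p j : c p (lift ord0 j) = p.2 j by rewrite ffunE liftK.
rewrite (reindex c) /=; last first.
  exists d => [p _ | f _].
    by case: p => t f; congr (_, _); rewrite ?c0 //; apply/ffunP => j; rewrite ffunE cl.
  apply/ffunP => j; rewrite !ffunE; case: unliftP => [i ->|-> //].
  by rewrite ffunE.
rewrite [RHS](eq_bigl (fun p : T * {ffun 'I_n -> T} =>
  P ord0 p.1 && [forall j, P (lift ord0 j) (p.2 j)])) => [|p].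
  rewrite -(pair_big_dep _ (fun (_ : T) (f :
    {ffun 'I_n -> T}) => [forall j, P (lift ord0 j) (f j)])
    (fun t f => F (a ++ [seq (x j (c (t, f) j), g j) | j <- enum 'I_n.+1]))) /=.
  apply: eq_bigr => t Pt; rewrite -cat_rcons.
  have /= -> := IH (rcons a (x ord0 t, g ord0)) (fun j => P (lift ord0 j))
    (fun j => x (lift ord0 j)) (fun j => g (lift ord0 j)).
    apply: eq_bigr => f _; rewrite map_enum_ordS c0 cat_rcons.
    by congr (F (_ ++ _ :: _)); apply: eq_map => j; rewrite cl.
  by rewrite size_rcons -sk addnS.
apply/forallP/andP => [Pp | [P0 /forallP Pl] j].
  split; first by have := Pp ord0; rewrite c0.
  by apply/forallP => j; have := Pp (lift ord0 j); rewrite cl.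
by case: (unliftP ord0 j) => [i ->|->]; rewrite ?c0 ?cl.
Qed.

End Multilinearity.

Section Ev.
Variables (C : fieldType) (V : lmodType {poly C}).

(* Once evaluated, [ev] is plain substitution into the letters of a word.     *)
Lemma leval_ev k n (phi : cmap V k) (L : 'I_k.-1 -> {mpoly C[n]}) (x : 'I_k -> V[λ n])
    (z : 'I_n -> C) w :
  multilinear phi -> size w = k ->
  (forall j : 'I_k, (w`_j).1 = leval z (x j)) ->
  (forall j : 'I_k.-1, (w`_j).2.1 = (L j).@[z]) ->
  leval z (ev phi L x) = word_eval phi w.
Proof.
move=> /word_eval_linear lin sw wx wL; rewrite /ev.
set D := \big[_/_]_(b < k) _.
have xD j : {subset lsupp (x j) <= D}.
  move=> m mx; rewrite /D; move: (mem_index_enum j).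
  elim: (index_enum 'I_k) => // i s IH; rewrite inE big_cons in_fsetU.
  by case: eqP => [<- _|_ /= /IH ->]; rewrite ?mx ?orbT.
(* Every letter is expanded over the common set [D] of monomials; multilinearity then yields exactly
   the sum over functions that defines [ev]. *)
have -> : w = [::] ++ [seq (\sum_(m : D) (mmap1 z (val m))%:P *: lcoef (val m) (x
  j), (w`_j).2) | j <- enum 'I_k].
  apply: (@eq_from_nth _ 0) => [|b]; first by rewrite size_map size_enum_ord.
  rewrite sw => bk; rewrite (nth_map (Ordinal bk)) ?size_enum_ord //.
  rewrite (nth_ord_enum _ (Ordinal bk)).
  rewrite -(big_seq_fsetE _ _ xpredT (fun m =>
    (mmap1 z m)%:P *: lcoef m (x (Ordinal bk)))) /=.
  by rewrite -(leval_wide _ (xD _)) -wx /=; case: (w`_b).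
rewrite (word_linear_bigA lin) // raddf_sum.
rewrite (eq_bigl (fun f : {ffun 'I_k -> D} => [forall j :
  'I_k, xpredT (f j)])) => [|f]; last by apply/esym/forallP.
apply: eq_bigr => f _.
rewrite (word_linear_prodZ lin) //= leval_lscale leval_lsubst; congr (_%:P *: _).
  by rewrite rmorph_prod; apply: eq_bigr => j _; rewrite /= mevalX.
apply: leval_word => i.
  by rewrite tnth_mktuple (nth_map i) ?size_enum_ord // nth_ord_enum.
have ik : (i < k)%N by apply: leq_trans (ltn_ord i) (leq_pred k).
rewrite (nth_map (Ordinal ik)) ?size_enum_ord //.
by rewrite (nth_ord_enum _ (Ordinal ik)) wL.
Qed.

End Ev.

(** * Trees *)

Section TreeWords.
Variables (C : fieldType) (V : lmodType {poly C}).
Variables (rho : forall k, cmap V k) (h : {linear V -> V}).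
Implicit Types (a b w u : seq (letter C V)) (T : ptree) (ts : seq ptree).

Definition rho_word w : V := word_eval (@rho (size w)) w.

(** The value of ρ_T. The letters of the children are written out in full to keep the recursion
    visibly structural; [tree_word_Node] restores the form with [forest_word]. *)
Fixpoint tree_word (T : ptree) (w : seq (letter C V)) : V :=
  if T is Node l f then
    rho_word
      [seq (let b := nth [::] (reshape [seq leaves (f j) | j <- enum 'I_l.+2] w) (val j) in
            (if is_leaf (f j) then tree_word (f j) b else h (tree_word (f j) b),
              word_total b))
      | j <- enum 'I_l.+2]
  else (w`_0).1.

(** The value of h ∘ ρ_T, with its convention at the trivial tree, as a letter for the next
    vertex. *)
Definition tree_letter (p : ptree * seq (letter C V)) : letter C V :=
  (if is_leaf p.1 then tree_word p.1 p.2 else h (tree_word p.1 p.2), word_total p.2).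

Definition forest_word ts w : seq (letter C V) :=
  [seq tree_letter p | p <- zip ts (reshape (map leaves ts) w)].

Lemma forest_word_cons T ts w :
  forest_word (T :: ts) w =
  tree_letter (T, take (leaves T) w) :: forest_word ts (drop (leaves T) w).
Proof. by []. Qed.

Lemma size_forest_word ts w : size (forest_word ts w) = size ts.
Proof. by rewrite size_map size_zip size_reshape size_map minnn. Qed.

Lemma tree_word_Node l (f : {ffun 'I_l.+2 -> ptree}) w :
  tree_word (Node f) w = rho_word (forest_word [seq f j | j <- enum 'I_l.+2] w).
Proof.
congr rho_word; rewrite /forest_word -map_comp.
have sf : size [seq f j | j <- enum 'I_l.+2] = l.+2 by rewrite size_map size_enum_ord.
apply: (@eq_from_nth _ 0) => [|m].
  by rewrite !(size_map _ (zip _ _), size_map _ (enum _)) size_zip size_reshape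
    !(size_map _ (enum _)) minnn.
rewrite size_map size_enum_ord => lm.
rewrite (nth_map (Ordinal lm)) ?size_enum_ord // (nth_ord_enum _ (Ordinal lm)).
rewrite (nth_map (Leaf, [::])) ?size_zip ?size_reshape ?(size_map _ (enum _))
  ?size_enum_ord ?minnn //.
rewrite nth_zip ?size_reshape ?(size_map _ (enum _)) //.
by rewrite (nth_map (Ordinal lm)) ?size_enum_ord // (nth_ord_enum _ (Ordinal lm)).
Qed.

Lemma word_total_forest_word ts w :
  size w = sumn (map leaves ts) -> word_total (forest_word ts w) = word_total w.
Proof.
elim: ts w => [|T ts IH] w sw; first by rewrite /forest_word (size0nil sw).
rewrite forest_word_cons word_total_cons IH; last by rewrite size_drop sw /= addKn.
by rewrite -word_total_cat cat_take_drop.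
Qed.

(** The marked letter falls into the block of exactly one tree [T]. The clause on empty lists says
    that it is last in the word precisely when it is last in its block and [T] is the last tree;
    sesquilinearity depends on this. *)
Lemma forest_word_insert ts a b :
  (size a + size b).+1 = sumn (map leaves ts) ->
  exists T a' b' u1 u3,
    [/\ T \in ts, (size a' + size b').+1 = leaves T,
        (size u1 + size u3).+1 = size ts,
        (b == [::]) = (b' == [::]) && (u3 == [::])
      & forall x, forest_word ts (a ++ x :: b) =
                  u1 ++ tree_letter (T, a' ++ x :: b') :: u3].
Proof.
elim: ts a => [|T ts IH] a //= sab.
have [aT|Ta] := ltnP (size a) (leaves T).
  exists T, a, (take (leaves T - (size a).+1) b), [::], (forest_word ts (drop
    (leaves T - (size a).+1) b)).
  have leT : (leaves T - (size a).+1 <= size b)%N.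
    by rewrite leq_subLR addSn sab leq_addr.
  split=> [|||| x].
  - by rewrite mem_head.
  - by rewrite size_takel // -addSn subnKC.
  - by rewrite size_forest_word.
  - apply/eqP/andP => [b0|[/eqP b0 /eqP u0]].
      rewrite b0 /=; split=> //; move: sab; rewrite b0 addn0.
      case: (ts) => //= S ts' sab; have := leaves_gt0 S; lia.
    have sb := congr1 size b0; rewrite size_takel //= in sb.
    have su := congr1 size u0; rewrite size_forest_word /= in su.
    by apply: size0nil; move: sab; rewrite (size0nil su) /=; lia.
  - by rewrite forest_word_cons take_cat drop_cat ltnNge ltnW //= -(subnSK aT).
have [|S [a' [b' [u1 [u3 [Sts sS su be E]]]]]] := IH (drop (leaves T) a).
  by rewrite size_drop; lia.
exists S, a', b', (tree_letter (T, take (leaves T) a) :: u1), u3; split=> //.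
  by rewrite inE Sts orbT.
  by rewrite /= addSn su.
move=> x; rewrite forest_word_cons takel_cat // drop_cat.
case: ltngtP Ta => // [_|aT] _; first by rewrite E.
by have := E x; rewrite aT subnn drop0 drop_size cat_cons => <-.
Qed.

Hypothesis rho_linear : forall k, word_linear k rho_word.
Hypothesis rho_sesqui : forall k, word_sesqui k rho_word.

Lemma sumn_leaves l (f : {ffun 'I_l.+2 -> ptree}) :
  sumn (map leaves [seq f j | j <- enum 'I_l.+2]) = leaves (Node f).
Proof. by rewrite sumnE 2!big_map big_enum. Qed.

Lemma rho_forest_linear ts :
  {in ts, forall T, word_linear (leaves T) (fun w => (tree_letter (T, w)).1)} ->
  word_linear (sumn (map leaves ts)) (fun w => rho_word (forest_word ts w)).
Proof.
move=> lin a b g c x y sab.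
have [T [a' [b' [u1 [u3 [Tts sT su _ E]]]]]] := forest_word_insert sab.
pose v z := (tree_letter (T, a' ++ (z, g) :: b')).1.
have tg z : tree_letter (T, a' ++ (z, g) :: b') = (v z, word_total (a' ++ (0, g) :: b')).
  by congr (_, _); rewrite /= !word_total_cat !word_total_cons.
rewrite !E !tg -(@rho_linear (size ts)) //; congr (rho_word (_ ++ (_, _) :: _)).
exact: lin.
Qed.

(** If the marked letter ends its block, its ∂ + z becomes ∂ plus the block total on the letter of
    [T]. That total is the variable this letter carries, so the rule for [rho] applies to it;
    otherwise the letter is already 0. *)
Lemma rho_forest_sesqui ts :
  {in ts, forall T, word_linear (leaves T) (fun w => (tree_letter (T, w)).1)} ->
  {in ts, forall T, word_sesqui (leaves T) (fun w => (tree_letter (T, w)).1)} ->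
  word_sesqui (sumn (map leaves ts)) (fun w => rho_word (forest_word ts w)).
Proof.
move=> lin ses a b x z d sab.
have [T [a' [b' [u1 [u3 [Tts sT su eb E]]]]]] := forest_word_insert sab.
pose v y := (tree_letter (T, a' ++ (y, (z, d)) :: b')).1.
have tg y : tree_letter (T, a' ++ (y, (z, d)) :: b') = (v y, word_total (a' ++ (x,
  (z, d)) :: b')).
  by congr (_, _); rewrite /= !word_total_cat !word_total_cons.
have tot : word_total (forest_word ts (a ++ (x, (z, d)) :: b)) = word_total (a ++
  (x, (z, d)) :: b).
  by apply: word_total_forest_word; rewrite size_cat /= addnS.
have vD : v ('X *: x + z%:P *: x) = if b' is [::] then
    ('X + (word_total (a' ++ (x, (z, d)) :: b')).1%:P) *: v x else 0.
  exact: ses.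
rewrite -{}tot !E !tg {}vD; move: (v x) => vx; clear v tg E.
case: b' sT eb => [|y b'] sT eb /=.
  rewrite scalerDl; case: (word_total (a' ++ [:: (x, (z, d))])) => zt dt /=.
  rewrite (rho_sesqui _ _ _ su).
  by case: u3 b su eb {sab} => [|? ?] [|? ?].
rewrite (word_linear0 (F := rho_word) (@rho_linear _) _ su).
by case: b eb {sab}.
Qed.

Lemma tree_letter_linear T :
  word_linear (leaves T) (fun w => (tree_letter (T, w)).1).
Proof.
elim/ptree_ind': T => [|l f IH] a b g c x y sab.
  by case: a sab => [|? ?] // [/eqP]; rewrite size_eq0 => /eqP ->.
rewrite /tree_letter [is_leaf _]/= !tree_word_Node.
have := @rho_forest_linear [seq f j | j <- enum 'I_l.+2].
rewrite sumn_leaves => lin.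
rewrite lin //; last by move=> T /mapP[j _ ->]; exact: IH.
by rewrite linearP.
Qed.

Lemma tree_letter_sesqui T :
  word_sesqui (leaves T) (fun w => (tree_letter (T, w)).1).
Proof.
elim/ptree_ind': T => [|l f IH] a b x z d sab.
  case: a sab => [|? ?] // [/eqP]; rewrite size_eq0 => /eqP -> /=.
  by rewrite word_total_cons /word_total big_nil addr0 /= scalerDl.
rewrite /tree_letter [is_leaf _]/= !tree_word_Node.
have := @rho_forest_sesqui [seq f j | j <- enum 'I_l.+2].
rewrite sumn_leaves => ses.
rewrite ses //.
- by case: (b); rewrite ?raddf0 // linearZ.
- by move=> T /mapP[j _ ->]; exact: tree_letter_linear.
- by move=> T /mapP[j _ ->]; exact: IH.
Qed.

Lemma tree_word_linear T : word_linear (leaves T) (tree_word T).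
Proof.
case: T => [|l f]; first exact: (@tree_letter_linear Leaf).
move=> a b g c x y sab; rewrite !tree_word_Node.
apply: rho_forest_linear; last by rewrite sumn_leaves.
by move=> T _; exact: tree_letter_linear.
Qed.

Lemma tree_word_sesqui T : word_sesqui (leaves T) (tree_word T).
Proof.
case: T => [|l f]; first exact: (@tree_letter_sesqui Leaf).
move=> a b x z d sab; rewrite !tree_word_Node.
apply: rho_forest_sesqui; last by rewrite sumn_leaves.
  by move=> T _; exact: tree_letter_linear.
by move=> T _; exact: tree_letter_sesqui.
Qed.

End TreeWords.

(** Identifies the offsets used by [reshape] with those of [block_comp]. *)
Lemma sumn_take_enum n (g : 'I_n -> nat) j :
  sumn (take j [seq g i | i <- enum 'I_n]) = (\sum_(i < n | (i < j)%N) g i)%N.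
Proof.
elim: n g j => [|n IH] g [|j].
- by rewrite take0 big_pred0.
- by rewrite big_ord0; have -> : enum 'I_0 = [::] by apply: size0nil; rewrite size_enum_ord.
- by rewrite take0 big_pred0.
rewrite map_enum_ordS /= IH [RHS]big_mkcond big_ord_recl /=; congr (_ + _)%N.
by rewrite big_mkcond; apply: eq_bigr.
Qed.

Section Congruence.
Variables (C : fieldType) (V U : lmodType {poly C}) (k : nat).
Variables F F' : seq (letter C V) -> U.
Hypothesis FF' : forall w, size w = k -> F w = F' w.

Let size_insert (a b : seq (letter C V)) x :
  (size a + size b).+1 = k -> size (a ++ x :: b) = k.
Proof. by rewrite size_cat /= addnS. Qed.

Lemma eq_word_linear : word_linear k F -> word_linear k F'.
Proof. by move=> lin a b g c x y sk; rewrite -!FF' ?lin //; exact: size_insert. Qed.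

Lemma eq_word_sesqui : word_sesqui k F -> word_sesqui k F'.
Proof.
by move=> ses a b x z d sk; rewrite -!FF' ?ses //; exact: size_insert.
Qed.

End Congruence.

Section RhoWord.
Variables (C : fieldType) (V : lmodType {poly C}) (rho : forall k, cmap V k).

Lemma rho_wordE k (w : seq (letter C V)) :
  size w = k -> rho_word rho w = word_eval (@rho k) w.
Proof. by move <-. Qed.

Hypothesis rhoP : forall k, (0 < k)%N -> conformal_sesquilinear (@rho k).

Lemma rho_word_linear k : word_linear k (rho_word rho).
Proof.
case: k => // k; apply: (@eq_word_linear _ _ _ _ (word_eval (@rho k.+1))).
  by move=> w /rho_wordE ->.
by apply: word_eval_linear; case: (rhoP (ltn0Sn k)).
Qed.

Lemma rho_word_sesqui k : word_sesqui k (rho_word rho).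
Proof.
case: k => // k; apply: (@eq_word_sesqui _ _ _ _ (word_eval (@rho k.+1))).
  by move=> w /rho_wordE ->.
exact/word_eval_sesqui/rhoP.
Qed.

End RhoWord.

(** * Agreement of the formal tree maps with the word functions *)

Section RhoTree.
Variables (C : numFieldType) (V : lmodType {poly C}).
Variables (rho : forall k, cmap V k) (h : {linear V -> V}).
Hypothesis rhoP : forall k, (0 < k)%N -> conformal_sesquilinear (@rho k).

Let h_leval n (z : 'I_n -> C) (x : V[λ n]) :
  leval z (coefmap h x) = h (leval z x).
Proof. by apply: leval_coefmap => *; rewrite ?linearZ //; exact: raddfB. Qed.

Lemma word_eval_h_rho T (phi : cmap V (leaves T)) w :
  word_eval (h_rho h phi) w =
  if is_leaf T then word_eval phi w else h (word_eval phi w).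
Proof. by rewrite /h_rho /word_eval; case: ifP => // _; rewrite h_leval. Qed.

(** By induction on [T]: [leval_ev] turns both levels of [block_comp] into substitution, and the
    offsets [off j] cut out the same blocks [bl j] as [reshape] does. *)
Lemma word_eval_rho_tree T w : size w = leaves T ->
  word_eval (rho_tree rho h T) w = tree_word rho h T w.
Proof.
elim/ptree_ind': T w => [|l f IH] w sw.
  by rewrite /word_eval leval_cst /thead tnth_mktuple.
(* Multilinearity of the children, required by [leval_ev], is read off from their word functions by
   the induction hypothesis. *)
have lin j : multilinear (h_rho h (rho_tree rho h (f j))).
  apply: multilinear_of_words.
  apply: (eq_word_linear _ (tree_letter_linear h (rho_word_linear rhoP) (T := f
    j))) => u su.
  by rewrite word_eval_h_rho IH.
set ts := [seq f j | j <- enum 'I_l.+2].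
have sts : size ts = l.+2 by rewrite size_map size_enum_ord.
rewrite tree_word_Node (@rho_wordE _ _ _ l.+2) ?size_forest_word //.
set n := leaves (Node f) in sw *.
set z := fun i : 'I_n.-1 => (w`_i).2.1.
have zE i : (i < n.-1)%N -> (lam n.-1 i).@[z] = (w`_i).2.1.
  by move=> ni; rewrite meval_lam insubT.
pose off j := (\sum_(i < l.+2 | (i < j)%N) leaves (f i))%N.
have offS j : off j.+1 = (off j + (if insub j is Some i then leaves (f i) else 0))%N.
  rewrite /off; case: insubP => [i jl ji|]; last first.
    rewrite -leqNgt addn0 => lj; apply: eq_bigl => i.
    by rewrite !(leq_trans (ltn_ord i)) // leqW.
  rewrite (bigD1 i) ?ji //= addnC; congr (_ + _)%N; apply: eq_bigl => m.
  by rewrite ltnS -val_eqE /= ji ltn_neqAle andbC.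
have offn j : (off j <= n)%N.
  by rewrite /n /= [X in (_ <= X)%N](bigID (fun i : 'I_l.+2 => (i < j)%N)) leq_addr.
have offnj (i : 'I_l.+2) : (off i + leaves (f i) <= n)%N.
  by have := offn i.+1; rewrite offS valK.
pose bl (j : 'I_l.+2) := take (leaves (f j)) (drop (off j) w).
have sbl j : size (bl j) = leaves (f j).
  rewrite size_takel // size_drop sw leq_subRL ?offn //; exact: offnj.
have nbl j i : (i < leaves (f j))%N -> (bl j)`_i = w`_(off j + i).
  by move=> ij; rewrite nth_take // nth_drop.
have nfw (j : 'I_l.+2) : (forest_word rho h ts w)`_j = tree_letter rho h (f j, bl j).
  rewrite (nth_map (Leaf, [::])) ?size_zip ?size_reshape ?(size_map leaves) ?sts ?minnn //.
  rewrite nth_zip ?size_reshape ?(size_map leaves) //; congr tree_letter; congr (_, _).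
    by rewrite (nth_map j) ?size_enum_ord // nth_ord_enum.
  rewrite nth_reshape -map_comp sumn_take_enum (nth_map j) ?size_enum_ord //.
  by rewrite nth_ord_enum.
apply: leval_ev; first by case: (rhoP (ltn0Sn l.+1)).
- by rewrite size_forest_word.
- move=> j; rewrite nfw /= -IH // -word_eval_h_rho; apply/esym.
  apply: leval_ev => // i.
    have oi : (off j + i < n)%N by have := offnj j; have := ltn_ord i; lia.
    by rewrite leval_cst nbl // -(nth_mktuple (fun i => (w`_i).1) 0 (Ordinal oi)).
  rewrite nbl; last by apply: leq_trans (ltn_ord i) (leq_pred _).
  rewrite zE //; have := offnj j; have := ltn_ord i; rewrite -/(off j); lia.
move=> j; have jl : (j < l.+2)%N by apply: leq_trans (ltn_ord j) (leq_pred _).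
rewrite (nfw (Ordinal jl)) /= -/(off j) -/(off j.+1).
have oj : off j.+1 = (off j + leaves (f (Ordinal jl)))%N.
  by rewrite offS insubT.
(* Block [j] is not the last one, so a leaf follows it and each of its indices carries a formal
   variable. *)
have oj' : (off j.+1 < n)%N.
  have jl' : (j.+1 < l.+2)%N by rewrite ltnS; exact: ltn_ord.
  have := offn j.+2; rewrite offS insubT; apply: leq_trans.
  by rewrite -addn1 leq_add2l leaves_gt0.
have shift (F : nat -> C) : \sum_(off j <= b < off j.+1) F b =
    \sum_(b < leaves (f (Ordinal jl))) F (off j + b)%N.
  rewrite oj -{1}[off j]add0n big_addn addKn big_mkord.
  by apply: eq_bigr => b _; rewrite addnC.
rewrite !raddf_sum /= (big_nth 0) sbl big_mkord shift; apply: eq_bigr => b _.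
by rewrite nbl // zE //; move: oj'; rewrite oj ltn_predRL => /(leq_trans _); apply;
  rewrite ltnS -addnS leq_add2l ltn_ord.
Qed.

Lemma rho_tree_multilinear T : multilinear (rho_tree rho h T).
Proof.
apply: multilinear_of_words.
apply: (eq_word_linear _ (tree_word_linear h (rho_word_linear rhoP) (T := T))) => w sw.
by rewrite word_eval_rho_tree.
Qed.

End RhoTree.

(** A composition is recovered from its shape by [reshape], so at most one term survives;
    [0 \notin sh] makes the reshaped blocks nonempty. *)
Lemma big_comps_shape (A : eqType) (Z : nmodType) (w : seq A) sh
    (F : seq (seq A) -> Z) : 0%N \notin sh ->
  \sum_(c <- comps w | shape c == sh) F c =
  if sumn sh == size w then F (reshape sh w) else 0.
Proof.
move=> sh0; case: eqP => sw.
  rewrite -big_filter (perm_big [:: reshape sh w]) ?big_seq1 //.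
  apply: uniq_perm => // [|c]; first exact/filter_uniq/comps_uniq.
  rewrite mem_filter mem_seq1 mem_comps.
  apply/idP/eqP => [/and3P[/eqP <- /eqP <- _]|->]; first by rewrite flattenK.
  rewrite reshapeKr ?reshapeKl ?sw // !eqxx /=.
  apply: contra sh0 => /(map_f size); rewrite -/(shape _) reshapeKl ?sw //.
rewrite big_seq_cond big_pred0 // => c; apply/negP; rewrite mem_comps.
move=> /andP[/andP[/eqP cw _] /eqP shc].
by case: sw; rewrite -cw size_flatten shc.
Qed.

(** Trees of different sizes get one common finite index type, as [word_linear_bigA] demands. *)
Lemma big_trees_sub (Z : nmodType) k n (G : ptree -> Z) : (k <= n)%N ->
  \sum_(T <- trees k) G T =
  \sum_(t : seq_sub (ptree_enum n) | leaves (val t) == k) G (val t).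
Proof.
move=> kn; rewrite -[RHS](big_map val (fun T => leaves T == k)) -[RHS]big_filter.
apply: perm_big; apply: uniq_perm; first exact: trees_uniq.
  by rewrite filter_uniq // map_inj_uniq ?index_enum_uniq //; exact: val_inj.
move=> T; rewrite mem_trees mem_filter andb_idr // => /eqP Tk.
have Tn : T \in ptree_enum n by apply: mem_ptree_enum; rewrite Tk.
by apply/mapP; exists (SeqSub Tn); rewrite ?mem_index_enum.
Qed.

Lemma trees1 : trees 1 = [:: Leaf].
Proof.
apply/perm_small_eq => //; apply: uniq_perm => // [|T]; first exact: trees_uniq.
rewrite mem_trees mem_seq1; case: T => [|l f]; first by rewrite !eqxx.
by rewrite gtn_eqF // (leq_trans _ (leaves_arity f)).
Qed.

Lemma size_comps (A : eqType) (w : seq A) (c : seq (seq A)) :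
  c \in comps w -> (size c <= size w)%N.
Proof.
rewrite mem_comps => /andP[/eqP <-].
elim: c => //= b c IH; rewrite inE negb_or size_cat => /andP[b0 /IH].
by case: b b0 => //= x b _ sc; rewrite ltnS (leq_trans sc) // leq_addl.
Qed.

Lemma size_block (A : eqType) (w : seq A) (c : seq (seq A)) b :
  c \in comps w -> (1 < size c)%N ->
  b \in c -> (size b < size w)%N.
Proof.
rewrite mem_comps => /andP[/eqP <- c0] c1 bc; rewrite size_flatten.
have p (d : seq A) : d \in c -> (0 < size d)%N by case: d => // ; rewrite (negPf c0).
case/splitPr: bc c1 p => c1 c2 sc p.
rewrite /shape map_cat sumn_cat /= addnCA -[X in (X < _)%N]addn0 ltn_add2l.
case: c1 sc p => [|d c1] sc p; last first.
  by rewrite /= -addnA addn_gt0 (p d) // mem_head.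
case: c2 sc p => [//|d c2] _ p.
by rewrite /= add0n addn_gt0 (p d) // !inE eqxx orbT.
Qed.

(** * Sums over all trees and their decomposition at the root *)

Section TreeSums.
Variables (C : fieldType) (V : lmodType {poly C}).
Variables (rho : forall k, cmap V k) (h : {linear V -> V}).
Hypothesis rho_linear : forall k, word_linear k (rho_word rho).
Implicit Types (w b : seq (letter C V)).

Definition sum_word w : V := \sum_(T <- trees (size w)) tree_word rho h T w.

(** This is Φ before [i] is applied to the letters. *)
Definition sum_letter w : letter C V :=
  (\sum_(T <- trees (size w)) (tree_letter rho h (T, w)).1, word_total w).

Lemma sum_letter1 x : sum_letter [:: x] = x.
Proof.
by rewrite /sum_letter trees1 big_seq1 /word_total big_seq1; case: x.
Qed.

Lemma sum_letterE w : (1 < size w)%N -> sum_letter w = (h (sum_word w), word_total w).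
Proof.
move=> w1; congr (_, _); rewrite raddf_sum !big_seq; apply: eq_bigr => -[|//].
by rewrite mem_trees => /eqP w1'; rewrite -w1' in w1.
Qed.

(* A tree with at least two leaves is the root grafted onto the trees of its  *)
(* children, whose leaves split the word into consecutive blocks.             *)
Lemma sum_word_comps w : (1 < size w)%N ->
  sum_word w = \sum_(c <- comps w | (1 < size c)%N) rho_word rho (map sum_letter c).
Proof.
move=> w1; rewrite /sum_word big_filter.
have [n sw] : exists n, size w = n.+1 by case: (size w) w1 => // n; exists n.
have enumS : ptree_enum n.+1 = Leaf :: [seq node_in g | l <- iota 0 n.+1,
    g <- enum {: {ffun 'I_l.+2 -> seq_sub (ptree_enum n)}}] by [].
rewrite sw enumS big_cons ifF; last first.
  by apply/negbTE; rewrite neq_ltn /= -sw w1.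
rewrite big_mkcond big_allpairs_dep.
(* Compositions are sorted by their number [l.+2] of blocks, which is the arity of the root. *)
transitivity (\sum_(l <- iota 0 n.+1) \sum_(c <- comps w | size c == l.+2)
    rho_word rho (map sum_letter c)); last first.
  rewrite (exchange_big_dep (fun c => (1 < size c)%N)) /=; last by move=> l c _ /eqP ->.
  rewrite big_seq_cond [RHS]big_seq_cond; apply: eq_bigr => c /andP[cw c1].
  rewrite -big_filter (eq_filter (a2 := pred1 (size c).-2)) => [|l].
    have lc : (size c).-2 \in iota 0 n.+1.
      rewrite mem_iota add0n ltnS leq0n -subn2 leq_subLR /=.
      by rewrite (leq_trans (size_comps cw)) // sw.
    by rewrite (filter_pred1_uniq (iota_uniq 0 n.+1) lc) big_seq1.
  by rewrite /=; lia.
apply: eq_bigr => l _; rewrite big_enum -big_mkcond /=.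
(* For fixed children [g] the only possible composition is the one whose block sizes are their leaf
   numbers. *)
transitivity (\sum_(g : {ffun 'I_l.+2 -> seq_sub (ptree_enum n)})
  \sum_(c <- comps w | shape c == [seq leaves (val (g j)) | j <- enum 'I_l.+2])
   rho_word rho [seq tree_letter rho h p | p <- zip [seq val (g j) | j <- enum 'I_l.+2] c]).
  rewrite [LHS]big_mkcond; apply: eq_bigr => g _.
  rewrite big_comps_shape; last first.
    by apply/mapP => -[j _ E]; have := leaves_gt0 (val (g j)); rewrite -E.
  pose f := [ffun j => val (g j)].
  have tsE : [seq val (g j) | j <- enum 'I_l.+2] = [seq f j | j <- enum 'I_l.+2].
    by apply: eq_map => j; rewrite ffunE.
  rewrite (map_comp leaves (fun j => val (g j))) tsE sumn_leaves sw.
  by case: ifP => // _; rewrite -tree_word_Node.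
rewrite (exchange_big_dep (fun c => size c == l.+2)) /=; last first.
  by move=> g c _ /eqP/(congr1 size); rewrite !(size_map size, size_map _ (enum _))
    size_enum_ord => ->.
rewrite big_seq_cond [RHS]big_seq_cond; apply: eq_bigr => c /andP[cw /eqP cl].
have cE : c = [seq nth [::] c (val j) | j <- enum 'I_l.+2].
  by rewrite map_comp val_enum_ord -cl [RHS]mkseq_nth.
rewrite [in RHS]cE.
have -> : map sum_letter [seq nth [::] c (nat_of_ord j) | j <- enum 'I_l.+2] =
  [seq (\sum_(t : seq_sub (ptree_enum n) | leaves (val t) == size (nth [::] c
    (nat_of_ord j)))
     (tree_letter rho h (val t, nth [::] c (nat_of_ord j))).1, word_total (nth [::]
       c (nat_of_ord j))) | j <- enum 'I_l.+2].
  rewrite -map_comp; apply: eq_map => j; congr (_, _); apply: big_trees_sub.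
  by rewrite -ltnS -sw; apply: (size_block cw); rewrite ?cl // mem_nth // cl.
rewrite -[X in rho_word rho X]cat0s.
(* Multilinearity of the root turns sums over trees in each letter into one sum over all families of
   children. *)
rewrite (word_linear_bigA (@rho_linear l.+2) (a := [::])
  (fun (j : 'I_l.+2) (t : seq_sub (ptree_enum n)) =>
    leaves (val t) == size (nth [::] c j))) //.
apply: eq_big => [g|g _].
  rewrite {1}cE /shape -map_comp; apply/eqP/forallP => [E j|E].
    by move/eq_in_map: E => /(_ j (mem_enum _ j)) /= ->.
  by apply: eq_map => j /=; apply/esym/eqP; exact: E.
by rewrite {1}cE zip_map -map_comp.
Qed.

End TreeSums.

(** * Transfer on words *)

(** The Koszul sign; [absz] preserves parity, so negative degrees are covered. *)
Definition int_sign (e : int) : int := (-1) ^+ absz e.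

Lemma int_signD e f : int_sign (e + f) = int_sign e * int_sign f.
Proof.
rewrite /int_sign -exprD -signr_odd -[RHS]signr_odd; congr (_ ^+ _).
lia.
Qed.

Lemma big_splits_nil_r (Z : nmodType) T (w : seq T) (f : seq T -> Z) :
  \sum_(p <- splits w) (if p.2 is [::] then f p.1 else 0) = f w.
Proof.
elim: w f => [|x w IH] f.
  by rewrite (big_splits_nil (fun u v => if v is [::] then f u else 0)).
rewrite (big_splits_cons _ _ (fun u v => if v is [::] then f u else 0)) add0r.
exact: (IH (fun u => f (x :: u))).
Qed.

Lemma big_comps1 (Z : nmodType) T (w : seq T) (f : seq T -> Z) : (0 < size w)%N ->
  \sum_(c <- comps w) (if c is [:: b] then f b else 0) = f w.
Proof.
case: w => // x w _; rewrite comps_first -(big_splits_nil_r w (fun u => f (x :: u))).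
by apply: eq_bigr => p _; rewrite big_comps_nil.
Qed.

(** A run of consecutive blocks in a composition is a subword with its own composition, and the run
    is nonempty exactly when the subword is. *)
Lemma splits3_comps (Z : nmodType) T (w : seq T)
    (f : seq (seq T) -> seq (seq T) -> seq (seq T) -> Z) :
  \sum_(c <- comps w) \sum_(p <- splits c) \sum_(q <- splits p.2 | (0 < size q.1)%N)
    f p.1 q.1 q.2 =
  \sum_(p <- splits w) \sum_(q <- splits p.2 | (0 < size q.1)%N)
  \sum_(c1 <- comps p.1) \sum_(c3 <- comps q.2) \sum_(c2 <- comps q.1) f c1 c2 c3.
Proof.
rewrite (comps_splits w (fun u v => \sum_(q <- splits v | (0 < size q.1)%N) f u q.1 q.2)).
apply: eq_bigr => p _; rewrite [RHS]exchange_big; apply: eq_bigr => c1 _.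
pose g (u v : seq (seq T)) := if (0 < size u)%N then f c1 u v else 0.
rewrite (eq_bigr (fun c => \sum_(q <- splits c) g q.1 q.2)) => [|c _];
  last exact: big_mkcond.
rewrite comps_splits /g {g}.
rewrite [RHS]big_mkcond; apply: eq_bigr => q _; rewrite exchange_big.
case: (q.1) => [|x u] /=.
  by rewrite big1 // => c3 _; rewrite big_seq1.
apply: eq_bigr => c3 _; rewrite !comps_first; apply: eq_bigr => r _.
by apply: eq_bigr.
Qed.

(** Both sides cut [w] into five parts: on the left an outer subword is chosen first and then one
    inside it, on the right the inner subword comes first. *)
Lemma splits5 (Z : nmodType) T (w : seq T)
    (f : seq T -> seq T -> seq T -> seq T -> seq T -> Z) :
  \sum_(p <- splits w) \sum_(q <- splits p.2) \sum_(r <- splits q.1)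
  \sum_(s <- splits r.2) f p.1 r.1 s.1 s.2 q.2 =
  \sum_(p <- splits w) \sum_(q <- splits p.2) \sum_(r <- splits p.1)
  \sum_(s <- splits q.2) f r.1 r.2 q.1 s.1 s.2.
Proof.
transitivity (\sum_(p <- splits w) \sum_(q <- splits p.2) \sum_(r <- splits q.2)
  \sum_(s <- splits r.2) f p.1 q.1 r.1 s.1 s.2).
  apply: eq_bigr => p _.
  rewrite (splits_assoc p.2 (fun b v e => \sum_(s <- splits v) f p.1 b s.1 s.2 e)).
  by apply: eq_bigr => q _; rewrite (splits_assoc q.2 (f p.1 q.1)).
rewrite -(splits_assoc w (fun a b t => \sum_(r <- splits t) \sum_(s <- splits r.2)
  f a b r.1 s.1 s.2)).
by apply: eq_bigr => p _; rewrite exchange_big.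
Qed.

Section Insertion.
Variables (C : fieldType) (U : lmodType {poly C}).
Implicit Types (w : seq (letter C U)).

(** The signed insertion product; for [F] and [G] equal to the structure its vanishing is the
    A_oo[1]-relation. The inserted letter loses one degree because [G] has degree -1. *)
Definition insertion (Z : zmodType) (F : seq (letter C U) -> Z)
    (G : seq (letter C U) -> U) w : Z :=
  \sum_(p <- splits w) \sum_(q <- splits p.2 | (0 < size q.1)%N)
    F (p.1 ++ (G q.1, word_total q.1 + (0, -1)) :: q.2)
      *~ int_sign (word_total p.1).2.

(** The summand [e] sees only words of one letter, which occur just when [G] is applied to all of
    [w], with sign 1. *)
Lemma insertion_split (Z Z' : zmodType) (F : seq (letter C U) -> Z')
    (k : {additive Z -> Z'}) (e : U -> Z') (R : seq (letter C U) -> Z) G w :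
  (0 < size w)%N ->
  (forall u, (0 < size u)%N -> F u = (if u is [:: x] then e x.1 else 0) + k (R u)) ->
  insertion F G w = e (G w) + k (insertion R G w).
Proof.
move=> w0 FE.
rewrite -(_ : \sum_(p <- splits w) (if p.1 is [::] then e (G p.2) else 0) = e (G w));
  last first.
  by rewrite (big_splits_nil_l w (fun u => e (G u))).
rewrite (raddf_sum k) -big_split [LHS]big_seq [RHS]big_seq;
  apply: eq_bigr => p /mem_splits pw /=.
rewrite (raddf_sum k).
under eq_bigr => q _ do rewrite FE ?size_cat ?addnS // mulrzDl -raddfMz.
rewrite big_split; congr (_ + _).
case: p pw => [[|x p1] p2] /= pw; last first.
  by rewrite big1 // => q _; case: (p1) => [|? ?]; rewrite mul0rz.
rewrite big_mkcond -(big_splits_nil_r p2 (fun u => e (G u))) [LHS]big_seq [RHS]big_seq.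
apply: eq_bigr => q /mem_splits qp /=.
have -> : int_sign (word_total ([::] : seq (letter C U))).2 = 1 by rewrite
  /word_total big_nil.
case: q qp => [q1 [|y q2]] /= qp; last by case: ifP; rewrite ?mul0rz.
by rewrite cats0 in qp; rewrite qp -pw in w0 *; rewrite w0.
Qed.

End Insertion.

(** * The transfer argument for functions on words *)

Section Transfer.
Variables (C : fieldType) (V W : gradedModType C).
Variables (rho1 : {linear V -> V}) (theta1 : {linear W -> W}).
Variables (p : {linear V -> W}) (i : {linear W -> V}) (h : {linear V -> V}).
Variables (M : seq (letter C V) -> V) (phi : seq (letter C W) -> letter C V).

Definition homogeneous (U : gradedModType C) (w : seq (letter C U)) :=
  forall x, x \in w -> in_degree x.2.2 x.1.

Lemma homogeneous_cat (U : gradedModType C) (w1 w2 : seq (letter C U)) :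
  homogeneous (w1 ++ w2) -> homogeneous w1 /\ homogeneous w2.
Proof. by move=> hw; split=> x xw; apply: hw; rewrite mem_cat xw ?orbT. Qed.

Definition higher (w : seq (letter C V)) : V := if (1 < size w)%N then M w else 0.

(** This is mu(Φ), with [higher] as mu. *)
Definition sum_blocks (w : seq (letter C W)) : V :=
  \sum_(c <- comps w) higher (map phi c).

Definition transferred (w : seq (letter C W)) : W :=
  if w is [:: x] then theta1 x.1 else p (sum_blocks w).

Hypothesis rho1_sq : forall v, rho1 (rho1 v) = 0.
Hypothesis theta1_sq : forall v, theta1 (theta1 v) = 0.
Hypothesis p_chain : forall v, p (rho1 v) = theta1 (p v).
Hypothesis i_chain : forall v, i (theta1 v) = rho1 (i v).
Hypothesis homotopy : forall v, i (p v) - v = rho1 (h v) + h (rho1 v).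
Hypothesis M_linear : forall k, word_linear k M.
Hypothesis M1 : forall x, M [:: x] = rho1 x.1.
Hypothesis M_rel : forall w, (0 < size w)%N -> homogeneous w -> insertion M M w = 0.
Hypothesis phi1 : forall x, phi [:: x] = (i x.1, x.2).
Hypothesis phiE : forall w, (1 < size w)%N -> phi w = (h (sum_blocks w), word_total w).
Hypothesis phi_degree : forall w, (0 < size w)%N -> homogeneous w ->
  in_degree (phi w).2.2 (phi w).1.

Lemma phi_total w : (0 < size w)%N -> (phi w).2 = word_total w.
Proof.
case: w => [|x [|y w]] // _; last by rewrite phiE.
by rewrite phi1 word_total_cons /word_total big_nil addr0.
Qed.

Lemma word_total_phi w c : c \in comps w -> word_total (map phi c) = word_total w.
Proof.
rewrite mem_comps => /andP[/eqP <-].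
elim: c => [|b c IH]; first by rewrite /word_total !big_nil.
rewrite inE negb_or => /andP[b0 /IH {}IH].
rewrite /= word_total_cat word_total_cons IH phi_total //.
by case: (b) b0.
Qed.

Lemma homogeneous_phi w c : c \in comps w -> homogeneous w -> homogeneous (map phi c).
Proof.
rewrite mem_comps => /andP[/eqP <- c0] hw x /mapP[b bc ->].
apply: phi_degree; first by case: (b) bc c0 => // ->.
by move=> y yb; apply: hw; apply/flattenP; exists b.
Qed.

Lemma sum_blocks_cons1 x : sum_blocks [:: x] = 0.
Proof. by rewrite /sum_blocks /= big_seq1. Qed.

(** This lemma and the next two bring [M], [phi] and [transferred] into the shape required by
    [insertion_split]. *)
Lemma M_higher w : (0 < size w)%N ->
  M w = (if w is [:: x] then rho1 x.1 else 0) + higher w.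
Proof. by case: w => [|x [|y w]] // _; rewrite /higher /= ?addr0 ?M1 // add0r. Qed.

Lemma phi_sum_blocks w : (0 < size w)%N ->
  (phi w).1 = (if w is [:: x] then i x.1 else 0) + h (sum_blocks w).
Proof.
case: w => [|x [|y w]] // _; first by rewrite phi1 sum_blocks_cons1 raddf0 addr0.
by rewrite phiE // add0r.
Qed.

Lemma transferred_sum_blocks w : (0 < size w)%N ->
  transferred w = (if w is [:: x] then theta1 x.1 else 0) + p (sum_blocks w).
Proof.
case: w => [|x [|y w]] // _; first by rewrite sum_blocks_cons1 raddf0 addr0.
by rewrite add0r.
Qed.

(* [phi] intertwines the two structures on the word w as soon as the homotopy *)
(* sees that rho1 anticommutes with the higher operations on w.               *)
Lemma phi_morphism w : (0 < size w)%N ->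
  rho1 (sum_blocks w) + insertion sum_blocks transferred w = 0 ->
  \sum_(c <- comps w) M (map phi c) = insertion (fun u => (phi u).1) transferred w.
Proof.
move=> w0 key.
rewrite (insertion_split (k := h) (e := i) _ w0 phi_sum_blocks).
have {key}-> : insertion sum_blocks transferred w = - rho1 (sum_blocks w).
  by apply/eqP; rewrite -addr_eq0 addrC key.
rewrite big_seq (eq_bigr (fun c => (if c is [:: b] then rho1 (phi b).1 else 0) +
  higher (map phi c))) => [|c]; last first.
  rewrite mem_comps => /andP[/eqP cw _]; rewrite M_higher; first by case: (c) => [|? []].
  by rewrite size_map; case: (c) cw w0 => // <-.
rewrite -big_seq big_split big_comps1 //= -/(sum_blocks w) phi_sum_blocks //.
rewrite transferred_sum_blocks // !raddfD raddfN /=.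
have := homotopy (sum_blocks w); move/eqP; rewrite subr_eq => /eqP ->.
have -> : i (if w is [:: x] then theta1 x.1 else 0) =
    rho1 (if w is [:: x] then i x.1 else 0).
  by case: (w) => [|x [|y u]]; rewrite ?raddf0.
by rewrite -!addrA; congr (_ + (_ + _)); rewrite addrCA subrr addr0.
Qed.

Lemma higher_linear k : word_linear k higher.
Proof.
move=> a b g c x y sk; rewrite /higher !size_cat /= !addnS.
by case: ifP => _; rewrite ?scaler0 ?addr0 ?(M_linear _ _ _ _ sk).
Qed.

Lemma higher_sum a b g (I : Type) (r : seq I) (P : pred I) (x : I -> V) :
  higher (a ++ (\sum_(k <- r | P k) x k, g) :: b) =
  \sum_(k <- r | P k) higher (a ++ (x k, g) :: b).
Proof. exact: (word_linear_sum (@higher_linear (size a + size b).+1)). Qed.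

Lemma higher_sign a b g x (e : int) :
  higher (a ++ (x *~ e, g) :: b) = higher (a ++ (x, g) :: b) *~ e.
Proof. exact: (word_linear_sign (@higher_linear (size a + size b).+1)). Qed.

(** The relations of [M] on the words [map phi c] are summed over all compositions [c] of [w]. The
    terms with outer [rho1] give the first summand; the others are regrouped by the subword to which
    the inner [M] is applied, where [phi_morphism] converts [M] into θ. *)
Lemma rho1_sum_blocks w : (0 < size w)%N -> homogeneous w ->
  rho1 (sum_blocks w) + insertion sum_blocks transferred w = 0.
Proof.
have [n] := ubnP (size w); elim: n w => // n IH w wn w0 hw.
have nz c : c \in comps w -> (0 < size c)%N.
  by rewrite mem_comps => /andP[/eqP cw _]; case: (c) cw w0 => // <-.
have : \sum_(c <- comps w) insertion M M (map phi c) = 0.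
  rewrite big_seq big1 // => c cw; apply: M_rel; first by rewrite size_map nz.
  exact: homogeneous_phi cw hw.
rewrite big_seq (eq_bigr (fun c => rho1 (M (map phi c)) + insertion higher M (map
  phi c))) => [|c cw]; last first.
  by apply: (insertion_split (k := idfun)) => [|u u0]; rewrite ?size_map ?nz ?M_higher.
rewrite -big_seq big_split /=.
(* The composition with a single block contributes only [rho1 (rho1 _)], which is 0. *)
have -> : \sum_(c <- comps w) rho1 (M (map phi c)) = rho1 (sum_blocks w).
  rewrite -!raddf_sum big_seq (eq_bigr (fun c =>
    (if c is [:: b] then rho1 (phi b).1 else 0) +
    higher (map phi c))) => [|c cw]; last first.
    by rewrite M_higher ?size_map ?nz //; case: (c) => [|? []].
  by rewrite -big_seq big_split big_comps1 // raddfD /= rho1_sq add0r.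
move=> <-; congr (_ + _).
pose x (u : seq (letter C W)) := (transferred u, word_total u + (0, -1)).
(* The word is cut into five: θ replaces [m], the block of the new letter also contains [b] and [d],
   and [a] and [e] are composed freely around that block. *)
pose f a b m d e : V := if (0 < size m)%N then
  \sum_(c1 <- comps a) \sum_(c3 <- comps e)
    higher (map phi c1 ++ phi (b ++ x m :: d) :: map phi c3)
      *~ int_sign (word_total (a ++ b)).2 else 0.
transitivity (\sum_(p <- splits w) \sum_(q <- splits p.2) \sum_(r <- splits p.1)
  \sum_(s <- splits q.2) f r.1 r.2 q.1 s.1 s.2).
  apply: eq_bigr => s _; rewrite big_mkcond; apply: eq_bigr => q _.
  rewrite /f; case: ifP => q0; last by rewrite !big1 // => r _; rewrite big1.
  rewrite /sum_blocks comps_insert mulrz_suml [LHS]big_seq [RHS]big_seq;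
    apply: eq_bigr => r /mem_splits <-.
  rewrite mulrz_suml; apply: eq_bigr => t _; rewrite mulrz_suml; apply: eq_bigr => c1 _.
  by rewrite mulrz_suml; apply: eq_bigr => c3 _; rewrite map_cat.
rewrite -splits5.
transitivity (\sum_(c <- comps w) \sum_(s <- splits c) \sum_(q <- splits s.2 | (0 <
  size q.1)%N)
  higher (map phi s.1 ++ (M (map phi q.1), word_total (map phi q.1) + (0, -1)) ::
    map phi q.2)
    *~ int_sign (word_total (map phi s.1)).2); last first.
  apply: eq_bigr => c _; rewrite /insertion map_splits [RHS]big_map;
    apply: eq_bigr => s _ /=.
  by rewrite map_splits [RHS]big_map; apply: eq_bigl => q; rewrite size_map.
rewrite (splits3_comps w (fun a b c => higher (map phi a ++
  (M (map phi b), word_total (map phi b) + (0, -1)) :: map phi c)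
   *~ int_sign (word_total (map phi a)).2)).
rewrite [LHS]big_seq [RHS]big_seq; apply: eq_bigr => s /mem_splits sw.
rewrite [RHS]big_mkcond [LHS]big_seq [RHS]big_seq; apply: eq_bigr => q /mem_splits qs.
have hq : homogeneous q.1.
  by move: hw; rewrite -sw -qs => /homogeneous_cat[_ /homogeneous_cat[]].
(* With the block [q.1] fixed, the sum over the position of θ inside it is the insertion of θ into
   Φ; the sign of [a ++ b] factors into an inner and an outer sign. *)
transitivity (\sum_(c1 <- comps s.1) \sum_(c3 <- comps q.2)
    higher (map phi c1 ++ (insertion (fun u => (phi u).1) transferred q.1,
      word_total q.1 + (0, -1))
      :: map phi c3) *~ int_sign (word_total s.1).2).
  pose y (r t : seq (letter C W) * seq (letter C W)) := (phi (r.1 ++ x t.1 :: t.2)).1.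
  pose F (c1 c3 : seq (seq (letter C W))) v := higher (map phi c1 ++ (v, word_total
    q.1 + (0, -1)) :: map phi c3).
  transitivity (\sum_(c1 <- comps s.1) \sum_(c3 <- comps q.2)
      \sum_(r <- splits q.1) \sum_(t <- splits r.2 | (0 < size t.1)%N)
        F c1 c3 (y r t) *~ int_sign (word_total r.1).2 *~ int_sign (word_total s.1).2).
    under [RHS]eq_bigr => c1 _ do rewrite exchange_big.
    rewrite [RHS]exchange_big; apply: eq_big_seq => r /mem_splits rq.
    under [RHS]eq_bigr => c1 _ do rewrite exchange_big.
    rewrite [RHS]exchange_big [RHS]big_mkcond; apply: eq_big_seq => t /mem_splits tr.
    rewrite /f; case: ifP => // _; apply: eq_bigr => c1 _; apply: eq_bigr => c3 _.
    rewrite word_total_cat int_signD mulrC mulrzA /F /y.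
    rewrite [phi _ in LHS]surjective_pairing phi_total ?size_cat ?addnS //.
    rewrite -rq -tr !word_total_cat word_total_cons /=.
    by rewrite [_ + (0, -1) + _]addrAC addrA.
  apply: eq_bigr => c1 _; apply: eq_bigr => c3 _.
  rewrite /insertion higher_sum mulrz_suml.
  apply: eq_bigr => r _.
  rewrite higher_sum mulrz_suml.
  by apply: eq_bigr => t _; rewrite higher_sign.
case: ifP => q0; last first.
  have -> : q.1 = [::] by case: (q.1) q0.
  rewrite big1 // => c1 _; rewrite big1 // => c3 _.
  by rewrite /insertion big_seq1 /= big_mkcond big_seq1 /= -[0](mulr0z 0)
    higher_sign !mulr0z mul0rz.
apply: eq_big_seq => c1 c1s; apply: eq_big_seq => c3 c3q.
rewrite (word_total_phi c1s) -mulrz_suml; congr (_ *~ _).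
transitivity (\sum_(c2 <- comps q.1) higher (map phi c1 ++
    (M (map phi c2), word_total q.1 + (0, -1)) :: map phi c3)); last first.
  by apply: eq_big_seq => c2 c2q; rewrite (word_total_phi c2q).
rewrite -higher_sum.
have [sq|sq] := ltnP (size q.1) (size w).
  by rewrite phi_morphism // IH // (leq_trans sq).
have /andP[/nilP s0 /nilP q20] : nilp s.1 && nilp q.2.
  by move: sq; rewrite -sw -qs !size_cat addnCA -[X in (_ <= X)%N]addn0 leq_add2l
    leqn0 addn_eq0.
move: c1s c3q; rewrite s0 q20 !mem_seq1 => /eqP -> /eqP ->.
by [].
Qed.

(** The outer [theta1] leaves θ_1 p mu(Φ), which cancels against p ρ_1 mu(Φ) since [p] is a chain
    map. *)
Lemma transferred_rel w : (0 < size w)%N -> homogeneous w ->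
  insertion transferred transferred w = 0.
Proof.
move=> w0 hw; rewrite (insertion_split (k := p) (e := theta1) _ w0 transferred_sum_blocks).
have /eqP := rho1_sum_blocks w0 hw; rewrite addrC addr_eq0 => /eqP ->.
rewrite raddfN /= p_chain transferred_sum_blocks // raddfD /=.
have -> : theta1 (if w is [:: x] then theta1 x.1 else 0) = 0.
  by case: (w) => [|x [|y u]]; rewrite ?raddf0 ?theta1_sq.
by rewrite add0r subrr.
Qed.

End Transfer.

(** * The relations on words *)

Section Relation.
Variables (C : fieldType) (V : gradedModType C) (rho : forall k, cmap V k).
Hypothesis rho_multilinear : forall k, (0 < k)%N -> multilinear (@rho k).

Let M := rho_word rho.

Let insert_term (w : seq (letter C V)) j l :=
  M (take j w ++ (M (take l (drop j w)), word_total (take l (drop j w)) + (0, -1))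
       :: drop l (drop j w)) *~ int_sign (word_total (take j w)).2.

(** Both sides reduce to pairs of a position [j] and a length [l >= 1] with [j + l <= n]; the outer
    arity is forced to be [n.+1 - l]. *)
Lemma insertion_nat n (w : seq (letter C V)) : size w = n ->
  insertion M M w = \sum_(1 <= k < n.+1)
    \sum_(1 <= l < n.+1 | (k + l == n.+1)%N) \sum_(j < k) insert_term w j l.
Proof.
move=> sw; transitivity (\sum_(0 <= j < n.+1) \sum_(1 <= l < n.+1)
    if (j + l <= n)%N then insert_term w j l else 0).
  have iotaE m : iota 0 m = index_iota 0 m by rewrite /index_iota subn0.
  rewrite /insertion {1}/splits big_map sw iotaE !big_nat.
  apply: eq_bigr => j; rewrite ltnS => /andP[_ jn].
  rewrite big_map size_drop sw iotaE big_ltn_cond // take0 /=.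
  rewrite -big_mkcond [RHS](eq_bigl (fun l => (l < (n - j).+1)%N)) => [|l]; last by lia.
  rewrite -(big_nat_widen 1 (n - j).+1 n.+1 xpredT) ?ltnS ?leq_subr //.
  rewrite big_nat_cond [RHS]big_nat_cond; apply: eq_bigl => l /=.
  rewrite size_take size_drop sw; have [->//|l0] := posnP l.
  have [lnj|] := ltnP l (n - j).+1; rewrite ?andbF //= ?andbT.
  by case: ifP => _; rewrite ?l0 // (leq_trans l0).
apply/esym; under eq_bigr => k _ do rewrite big_mkcond.
transitivity (\sum_(1 <= k < n.+1) \sum_(1 <= l < n.+1) \sum_(0 <= j < n.+1)
    if (k == n.+1 - l)%N then (if (j + l <= n)%N then insert_term w j l else 0) else 0).
  rewrite !big_nat; apply: eq_bigr => k /andP[k0 kn].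
  rewrite !big_nat; apply: eq_bigr => l /andP[l0 ln].
  have -> : (k + l == n.+1)%N = (k == n.+1 - l)%N by lia.
  case: eqP => [kE|_]; last by rewrite big1.
  rewrite -(big_mkord xpredT (fun j => insert_term w j l)) (big_nat_widen 0 k n.+1)
    ?(ltnW kn) // big_mkcond.
  apply: eq_bigr => j _ /=; rewrite kE; congr (if _ then _ else _); lia.
rewrite exchange_big_nat /= [RHS]exchange_big_nat /= !big_nat;
  apply: eq_bigr => l /andP[l0 ln].
rewrite exchange_big_nat; apply: eq_bigr => j _ /=.
rewrite -big_mkcond big_nat1_eq ifT //; lia.
Qed.

Lemma leval_Ainf n (v : n.-tuple V) (d : 'I_n -> int) (z : 'I_n.-1 -> C) w :
  size w = n -> (forall i : 'I_n, (w`_i).1 = tnth v i) ->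
  (forall i : 'I_n.-1, (w`_i).2.1 = z i) -> (forall i : 'I_n, (w`_i).2.2 = d i) ->
  leval z (\sum_(1 <= k < n.+1) \sum_(1 <= l < n.+1 | (k + l == n.+1)%N)
    \sum_(j < k)
      ev (@rho k)
        (fun a : 'I_k.-1 =>
           if (a < j)%N then lam n.-1 a
           else if a == j :> nat then \sum_(j <= b < j + l) lam n.-1 b
           else lam n.-1 (a + l.-1))
        (fun a : 'I_k =>
           if (a < j)%N then cst n.-1 v`_a
           else if a == j then
             ev (@rho l) (fun b : 'I_l.-1 => lam n.-1 (j + b))
                        (fun b : 'I_l => cst n.-1 v`_(j + b))
           else cst n.-1 v`_(a + l.-1))
      *~ (-1) ^+ absz (\sum_(a < n | (a < j)%N) d a)) = insertion M M w.
Proof.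
move=> sw wv wz wd; rewrite (insertion_nat sw).
have vE a : (a < n)%N -> v`_a = (w`_a).1.
  by move=> an; rewrite (wv (Ordinal an)) (tnth_nth 0).
have zE a : (a < n.-1)%N -> (lam n.-1 a).@[z] = (w`_a).2.1.
  by move=> an; rewrite meval_lam insubT (wz (Ordinal an)).
rewrite raddf_sum big_nat_cond [RHS]big_nat_cond; apply: eq_bigr => k /andP[/andP[k0 _] _].
rewrite raddf_sum big_nat_cond [RHS]big_nat_cond.
apply: eq_bigr => l /andP[/andP[l0 _] /eqP kl].
rewrite raddf_sum; apply: eq_bigr => j _.
have jk := ltn_ord j; rewrite raddfMz /insert_term.
have -> : (-1) ^+ absz (\sum_(a < n | (a < j)%N) d a) = int_sign (word_total (take
  j w)).2 :> int.
  have jn : (j <= n)%N by lia.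
  rewrite -/(int_sign _) /word_total raddf_sum /= (big_nth 0) size_takel ?sw // big_mkord.
  rewrite (eq_bigr (fun a : 'I_n => (w`_a).2.2)) => [|a _]; last exact/esym/wd.
  rewrite -(big_ord_widen n (fun a => (w`_a).2.2) jn); congr int_sign.
  by apply: eq_bigr => a _; rewrite nth_take.
congr (_ *~ _).
have sj : size (take j w) = j by rewrite size_takel // sw; lia.
have sl : size (take l (drop j w)) = l by rewrite size_takel // size_drop sw; lia.
have nl b : (b < l)%N -> (take l (drop j w))`_b = w`_(j + b).
  by move=> bl; rewrite nth_take // nth_drop.
have shift (F : nat -> C) : \sum_(j <= b < j + l) F b = \sum_(b < l) F (j + b)%N.
  rewrite -{1}[nat_of_ord j]add0n big_addn addKn big_mkord.
  by apply: eq_bigr => b _; rewrite addnC.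
rewrite /M (@rho_wordE _ _ _ k); last by rewrite size_cat /= sj !size_drop sw; lia.
apply: leval_ev.
- exact: rho_multilinear.
- by rewrite size_cat /= sj !size_drop sw; lia.
- move=> a; rewrite nth_cat sj; case: ltnP => aj;
  first by rewrite leval_cst nth_take // vE //; lia.
  case: eqP => [->|/eqP aj'].
    rewrite subnn /= (@rho_wordE _ _ _ l) //; apply/esym; apply: leval_ev => //.
    + exact: rho_multilinear.
    + by move=> b; rewrite leval_cst nl // vE //; have := ltn_ord b; lia.
    + by move=> b; have := ltn_ord b => bl; rewrite nl ?zE //; lia.
  have ja : (j < a)%N by rewrite ltn_neqAle aj andbT eq_sym.
  rewrite -(subnSK ja) /= !nth_drop leval_cst vE; last by have := ltn_ord a; lia.
  by congr (w`_ _).1; lia.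
move=> a; have ak := ltn_ord a.
rewrite nth_cat sj; case: ltnP => aj; first by rewrite nth_take // zE //; lia.
(* The inserted letter carries the sum of the variables of its subword, which is the summed
   subscript of the relation; the shift [(0, -1)] affects the degree only. *)
case: eqP => [aj'|/eqP aj'].
  rewrite aj' subnn /= /word_total !raddf_sum /= shift.
  rewrite (big_nth 0) sl big_mkord addr0; apply: eq_bigr => b _.
  by rewrite nl // zE //; have := ltn_ord b; lia.
have ja : (j < a)%N by rewrite ltn_neqAle aj andbT eq_sym.
rewrite -(subnSK ja) /= !nth_drop zE; last by lia.
by congr (w`_ _).2.1; lia.
Qed.

End Relation.

(** * Degrees of the tree operations *)

Section TreeDegrees.
Variables (C : fieldType) (V : gradedModType C).
Variables (rho : forall k, cmap V k) (h : {linear V -> V}).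
Hypothesis rho_degree : forall k, (0 < k)%N -> has_degree (- 1) (@rho k).
Hypothesis h_degree : lin_degree 1 h.

Lemma rho_word_degree w : (0 < size w)%N -> homogeneous w ->
  in_degree ((word_total w).2 - 1) (rho_word rho w).
Proof.
move=> w0 hw; rewrite /word_total raddf_sum /= (big_nth 0) big_mkord.
apply: in_degree_leval => m.
apply: (rho_degree w0 (d := fun j : 'I_(size w) => (w`_j).2.2)) => j.
by rewrite tnth_mktuple; apply: hw; apply: mem_nth.
Qed.

(** Each vertex lowers the degree by 1 and each [h] raises it by 1, so letters keep the total degree
    of their block and only the root, not followed by [h], leaves -1. *)
Lemma tree_degrees T w : size w = leaves T -> homogeneous w ->
  in_degree (word_total w).2 (tree_letter rho h (T, w)).1 /\
  (~~ is_leaf T -> in_degree ((word_total w).2 - 1) (tree_word rho h T w)).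
Proof.
elim/ptree_ind': T w => [|l f IH] w sw hw.
  case: w sw hw => [|x [|]] // _ hw; split=> //.
  rewrite word_total_cons /word_total big_nil addr0; apply: hw.
  exact: mem_head.
have forest ts u : {in ts, forall T, exists j, T = f j} ->
    size u = sumn (map leaves ts) -> homogeneous u -> homogeneous (forest_word rho h ts u).
  elim: ts u => [|T ts IHts] u tsf su hu x; first by rewrite in_nil.
  have leu : (leaves T <= size u)%N by rewrite su /= leq_addr.
  have [hu1 hu2] : homogeneous (take (leaves T) u) /\ homogeneous (drop (leaves T) u).
    by apply: homogeneous_cat; rewrite cat_take_drop.
  rewrite forest_word_cons in_cons => /orP[/eqP ->|].
    have [j Tj] := tsf T (mem_head _ _); rewrite Tj.
    by case: (IH j (take (leaves (f j)) u)); rewrite -?Tj // size_takel.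
  apply: IHts => // [S Sts|]; first by apply: tsf; rewrite in_cons Sts orbT.
  by rewrite size_drop su /= addKn.
have deg : in_degree ((word_total w).2 - 1) (tree_word rho h (Node f) w).
  rewrite tree_word_Node -(@word_total_forest_word _ _ rho h [seq f j | j <- enum
    'I_l.+2] w);
    last by rewrite sumn_leaves.
  apply: rho_word_degree; first by rewrite size_forest_word size_map size_enum_ord.
  apply: forest => //; last by rewrite sumn_leaves.
  by move=> T /mapP[j _ ->]; exists j.
split=> //; rewrite /tree_letter [is_leaf _]/= /=.
by have := h_degree deg; rewrite subrK.
Qed.

Lemma sum_word_degree w : (1 < size w)%N -> homogeneous w ->
  in_degree ((word_total w).2 - 1) (sum_word rho h w).
Proof.
move=> w1 hw; rewrite /sum_word big_seq; apply: in_degree_sum => -[|l f].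
  by rewrite mem_trees => /eqP sw; rewrite -sw in w1.
by rewrite mem_trees => /eqP/esym sw; case: (tree_degrees sw hw) => _; apply.
Qed.

Lemma sum_letter_degree w : homogeneous w ->
  in_degree (sum_letter rho h w).2.2 (sum_letter rho h w).1.
Proof.
move=> hw; rewrite /sum_letter big_seq; apply: in_degree_sum => T.
by rewrite mem_trees => /eqP/esym sw; case: (tree_degrees sw hw).
Qed.

End TreeDegrees.

(** * Sesquilinearity of the sums over trees *)

Section TreeSumWords.
Variables (C : fieldType) (V : lmodType {poly C}).
Variables (rho : forall k, cmap V k) (h : {linear V -> V}).
Hypothesis rho_linear : forall k, word_linear k (rho_word rho).
Hypothesis rho_sesqui : forall k, word_sesqui k (rho_word rho).

Lemma sum_word_linear k : word_linear k (sum_word rho h).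
Proof.
move=> a b g c x y sk; rewrite /sum_word !size_cat /= !addnS sk.
rewrite scaler_sumr -big_split; apply: eq_big_seq => T.
by rewrite mem_trees => /eqP Tk; apply: tree_word_linear => //; rewrite sk.
Qed.

Lemma sum_word_sesqui k : word_sesqui k (sum_word rho h).
Proof.
move=> a b x z d sk; rewrite /sum_word !size_cat /= !addnS sk.
rewrite (eq_big_seq (fun T => if b is [::] then
  ('X + (word_total (a ++ (x, (z, d)) :: b)).1%:P) *: tree_word rho h T (a ++ (x,
    (z, d)) :: b)
  else 0)) => [|T].
  by case: (b) => [|? ?]; [rewrite scaler_sumr | rewrite big1].
by rewrite mem_trees => /eqP Tk; apply: tree_word_sesqui => //; rewrite sk.
Qed.

End TreeSumWords.

(** * The transferred maps as functions on words *)

Section TransferWords.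
Variables (C : numFieldType) (V W : gradedModType C).
Variables (theta1 : {linear W -> W}).
Variables (p : {linear V -> W}) (i : {linear W -> V}) (h : {linear V -> V}).
Variable rho : forall k, cmap V k.
Hypothesis rhoP : forall k, (0 < k)%N -> conformal_sesquilinear (@rho k).

Definition map_word (w : seq (letter C W)) : seq (letter C V) :=
  [seq (i x.1, x.2) | x <- w].

Lemma size_map_word w : size (map_word w) = size w.
Proof. exact: size_map. Qed.

Lemma word_total_map_word w : word_total (map_word w) = word_total w.
Proof. exact: big_map. Qed.

Lemma leval_tree_sum k (v : k.-tuple V) (z : 'I_k.-1 -> C) w : size w = k ->
  (forall j : 'I_k, (w`_j).1 = tnth v j) ->
  (forall j : 'I_k.-1, (w`_j).2.1 = z j) ->
  leval z (tree_sum rho h v) = sum_word rho h w.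
Proof.
move=> sw wv wz; rewrite /tree_sum raddf_sum /sum_word sw.
apply: eq_big_seq => T; rewrite mem_trees => /eqP Tk /=.
have wT : size w = leaves T by rewrite Tk.
rewrite -(word_eval_rho_tree h rhoP wT); apply: leval_ev => //.
- exact: rho_tree_multilinear.
- move=> j; rewrite leval_cst; have jk : (j < k)%N by rewrite -Tk.
  by rewrite (wv (Ordinal jk)) (tnth_nth 0).
- move=> j; have jk : (j < k.-1)%N by rewrite -Tk.
  by rewrite meval_lam insubT (wz (Ordinal jk)).
Qed.

Definition transfer_word (w : seq (letter C W)) : W :=
  if w is [:: x] then theta1 x.1 else p (sum_word rho h (map_word w)).

Lemma word_eval_transfer k w : size w = k -> (0 < k)%N ->
  word_eval (transfer theta1 p i h rho (k := k)) w = transfer_word w.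
Proof.
case: k => [|[|k]] // sw _.
  case: w sw => [|x []] // _; rewrite /word_eval /transfer eqxx leval_cst.
  congr (theta1 _); exact: (nth_mktuple (fun j : 'I_1 => ([:: x]`_j).1) 0 ord0).
rewrite /word_eval /transfer /= leval_coefmap; first last.
- by move=> c v; rewrite linearZ.
- exact: raddfB.
rewrite (@leval_tree_sum k.+2 _ _ (map_word w)) ?size_map_word //.
- by case: w sw => [|x [|y w]].
- move=> j; by rewrite (nth_map 0) ?sw // tnth_map tnth_mktuple.
- by move=> j; rewrite (nth_map 0) // sw (leq_trans (ltn_ord j)) ?leq_pred.
Qed.

Lemma map_word_cat a b x g : map_word (a ++ (x, g) :: b) = map_word a ++ (i x, g)
  :: map_word b.
Proof. by rewrite /map_word map_cat. Qed.

Lemma transfer_word_linear k : word_linear k transfer_word.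
Proof.
move=> a b g c x y sk; rewrite /transfer_word.
(* Only a word of one letter uses [theta1]; all longer words take the other branch, whichever letter
   is inserted. *)
have [[-> ->]|ab] : (a = [::] /\ b = [::]) \/ (0 < size a + size b)%N.
  by case: a b {sk} => [|? ?] [|? ?]; [left | right | right | right; rewrite addSn].
  by rewrite /= linearP.
have E z : (if a ++ (z, g) :: b is [:: t] then theta1 t.1 else p (sum_word rho h
  (map_word (a ++ (z, g) :: b))))
    = p (sum_word rho h (map_word a ++ (i z, g) :: map_word b)).
  by rewrite map_word_cat; case: a b ab {sk} => [|? [|? ?]] [|? ?].
rewrite !E linearP.
rewrite (@sum_word_linear _ _ _ h (rho_word_linear rhoP) k) ?size_map_word //.
by rewrite linearP.
Qed.

Lemma transfer_word_sesqui k : word_sesqui k transfer_word.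
Proof.
move=> a b x z d sk; rewrite /transfer_word.
have [[-> ->]|ab] : (a = [::] /\ b = [::]) \/ (0 < size a + size b)%N.
  by case: a b {sk} => [|? ?] [|? ?]; [left | right | right | right; rewrite addSn].
  by rewrite /= word_total_cons /word_total big_nil addr0 (linearD theta1) !linearZ
    /= scalerDl.
have E t : (if a ++ (t, (z, d)) :: b is [:: t'] then theta1 t'.1
      else p (sum_word rho h (map_word (a ++ (t, (z, d)) :: b))))
    = p (sum_word rho h (map_word a ++ (i t, (z, d)) :: map_word b)).
  by rewrite map_word_cat; case: a b ab {sk} => [|? [|? ?]] [|? ?].
rewrite !E (linearD i) !linearZ /=.
rewrite (@sum_word_sesqui _ _ _ h (rho_word_linear rhoP) (rho_word_sesqui rhoP) k)
  ?size_map_word //.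
rewrite -(map_word_cat a b x) word_total_map_word.
by case: (b) => [|? ?]; rewrite ?raddf0 // linearZ.
Qed.

End TransferWords.

Lemma insertion_eq (C : fieldType) (U : lmodType {poly C}) (Z : zmodType)
    (F F' : seq (letter C U) -> Z) (G G' : seq (letter C U) -> U) w :
  (forall u, (0 < size u)%N -> F u = F' u) ->
  (forall u, (0 < size u)%N -> G u = G' u) -> insertion F G w = insertion F' G' w.
Proof.
move=> FF GG; apply: eq_bigr => p _; apply: eq_bigr => q q0.
by rewrite GG // FF // size_cat addnS.
Qed.

(** Like [tuple_word], but with prescribed degrees, which the signs and homogeneity require. *)
Lemma word_of_tuple (C : fieldType) (U : lmodType {poly C}) k (z : 'I_k.-1 -> C)
    (v : k.-tuple U) (d : 'I_k -> int) :
  exists w : seq (letter C U), [/\ size w = k,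
    forall j : 'I_k, (w`_j).1 = tnth v j,
    forall j : 'I_k.-1, (w`_j).2.1 = z j
  & forall j : 'I_k, (w`_j).2.2 = d j].
Proof.
exists [seq (tnth v j, (if insub (val j) is Some i then z i else 0, d j)) | j <- enum 'I_k].
split=> [|j|j|j]; first by rewrite size_map size_enum_ord.
- by rewrite (nth_map j) ?size_enum_ord // nth_ord_enum.
- have jk : (j < k)%N by apply: leq_trans (ltn_ord j) (leq_pred k).
  rewrite (nth_map (Ordinal jk)) ?size_enum_ord // (nth_ord_enum _ (Ordinal jk)) /=.
  by rewrite valK.
by rewrite (nth_map j) ?size_enum_ord // nth_ord_enum.
Qed.

Lemma homogeneous_nth (C : fieldType) (U : gradedModType C) (w : seq (letter C U)) :
  (forall j, (j < size w)%N -> in_degree (w`_j).2.2 (w`_j).1) -> homogeneous w.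
Proof. by move=> hw x /(nthP 0)[j jw <-]; exact: hw. Qed.

(** * Transfer of the structure along the contraction *)

Theorem theorem3p15 (R : realType) (V W : gradedModType R[i])
    (rho1 : {linear V -> V}) (theta1 : {linear W -> W})
    (p : {linear V -> W}) (i : {linear W -> V}) (h : {linear V -> V})
    (rho : forall k, cmap V k) :
  chain_complex rho1 -> chain_complex theta1 ->
  contraction rho1 theta1 p i h ->
  Ainf_conformal_on rho1 rho ->
  Ainf_conformal_on theta1 (transfer theta1 p i h rho).
Proof.
move=> [_ rho1_sq] [theta1_degree theta1_sq].
move=> [[p_degree p_chain] [i_degree i_chain] h_degree homotopy _].
move=> [[rhoP rho_rel] rho1E].
have rhoS k (k0 : (0 < k)%N) := (rhoP k k0).1.
have rhoD k (k0 : (0 < k)%N) := (rhoP k k0).2.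
have rho_lin := rho_word_linear rhoS.
pose M := rho_word rho; pose theta := transfer theta1 p i h rho.
(* [phi] is Φ and [tw] is θ on words. *)
pose phi w := sum_letter rho h (map_word i w).
pose tw := transfer_word theta1 p i h rho.
have twE k w : size w = k -> (0 < k)%N -> word_eval (@theta k) w = tw w.
  exact: word_eval_transfer.
have map_word_homogeneous w : homogeneous w -> homogeneous (map_word i w).
  move=> hw x /mapP[y yw ->] /=.
  by have := i_degree _ _ (hw _ yw); rewrite addr0.
(* The root decomposition of trees identifies the sum of ρ_T ∘ i with mu(Φ). *)
have sum_blocksE w : (1 < size w)%N ->
    sum_word rho h (map_word i w) = sum_blocks M phi w.
  move=> w1; rewrite sum_word_comps ?size_map_word //.
  rewrite /map_word comps_map big_map big_mkcond; apply: eq_bigr => c _.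
  by rewrite /higher !size_map -map_comp.
have theta_linear k : (0 < k)%N -> word_linear k (word_eval (@theta k)).
  move=> k0; apply: (eq_word_linear _ (transfer_word_linear theta1 p i h rhoS (k :=
    k))) => w sw.
  by rewrite twE.
have theta_sesqui k : (0 < k)%N -> conformal_sesquilinear (@theta k).
  move=> k0; apply: sesquilinear_of_words; first exact: theta_linear.
  apply: (eq_word_sesqui _ (transfer_word_sesqui theta1 p i h rhoS (k := k))) => w sw.
  by rewrite twE.
(* In arity 1 [transfer] is [theta1] by definition. *)
split; last by [].
split=> [k k0|n n0 v d hv].
  split; first exact: theta_sesqui.
  move=> v d hv; apply: in_degree_lcoef => z.
  have [w [sw wv wz wd]] := word_of_tuple z v d.
  have hw : homogeneous w.
    apply: homogeneous_nth => j; rewrite sw => jk.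
    by rewrite (wv (Ordinal jk)) (wd (Ordinal jk)).
  rewrite (leval_word _ wv wz) twE //.
  have -> : \sum_(j < k) d j = (word_total w).2.
    rewrite /word_total raddf_sum /= (big_nth 0) sw big_mkord.
    by apply: eq_bigr => j _; rewrite wd.
  have [w1|w1] := ltnP 1 (size w); last first.
    case: w sw hw w1 {wv wz wd} => [|x [|]] //; first by move=> sw; rewrite -sw in k0.
    move=> _ hw _; rewrite word_total_cons /word_total big_nil addr0.
    by apply: theta1_degree; apply: hw; exact: mem_head.
  have -> : tw w = p (sum_word rho h (map_word i w)) by case: (w) w1 => [|? []].
  have := sum_word_degree rhoD h_degree (w := map_word i w).
  rewrite size_map_word word_total_map_word => /(_ w1 (map_word_homogeneous _ hw)).
  by move/p_degree; rewrite addr0.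
(* The relation is an identity of polynomials and may be checked at every point [z]. *)
apply: leval_inj => z; rewrite raddf0.
have [w [sw wv wz wd]] := word_of_tuple z v d.
have hw : homogeneous w.
  apply: homogeneous_nth => j; rewrite sw => jn.
  by rewrite (wv (Ordinal jn)) (wd (Ordinal jn)).
rewrite (leval_Ainf _ sw wv wz wd) => [|k k0]; last by case: (theta_sesqui k k0).
have thetaE u : (0 < size u)%N -> rho_word theta u = transferred theta1 p M phi u.
  move=> u0; rewrite /rho_word twE //.
  by case: u u0 => [|x [|y u]] // _; rewrite /tw /transfer_word sum_blocksE.
rewrite (insertion_eq _ thetaE thetaE).
apply: (@transferred_rel _ _ _ rho1 theta1 p i h M phi) => //; last by rewrite sw.
- move=> x; rewrite /M (@rho_wordE _ _ _ 1) //.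
  rewrite -(@leval_word _ _ 1 (rho 1%N) (fun=> 0) [tuple x.1]) ?rho1E ?leval_cst //.
    by move=> j; rewrite (ord1 j).
  by case.
- move=> u u0 hu.
  have := rho_rel _ u0 [tuple (u`_j).1 | j < size u] (fun j => (u`_j).2.2).
  move=> /(_ _)/(congr1 (leval (fun j : 'I_(size u).-1 => (u`_j).2.1))).
  rewrite raddf0 (leval_Ainf _ (w := u)) //.
  + by apply => j; rewrite tnth_mktuple; apply: hu; apply: mem_nth.
  + by move=> k k0; case: (rhoS k k0).
  + by move=> j; rewrite tnth_mktuple.
- by move=> x; rewrite /phi sum_letter1.
- by move=> u u1; rewrite /phi sum_letterE ?size_map_word // sum_blocksE //
  word_total_map_word.
- by move=> u u0 hu; apply: sum_letter_degree => //; exact: map_word_homogeneous.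
Qed.
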